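(* No SNN polynomial of degree $5$ having a root outside the vertical strip $\{z\in\mathbb{C}:-5\leq\mathrm{Re}(z)\leq 4\}$ is an Ehrhart polynomial. Therefore, every root $\alpha\in\mathbb{C}$ of an Ehrhart polynomial of degree $5$ satisfies $-5\leq\mathrm{Re}(\alpha)\leq 4$, whereas this does not hold for all SNN polynomials of degree $5$ (there exists an SNN polynomial of degree $5$ with a root outside this strip).
   Context: For an integer $k$ and a positive integer $d$, $\binom{t+k}{d}$ denotes the polynomial $\frac{(t+k)(t+k-1)\cdots(t+k-d+1)}{d!}$ in $t$. Every polynomial $f$ of degree $d$ over $\mathbb{C}$ can be written uniquely as $f(t)=\sum_{j=0}^d h_j^*\binom{t+d-j}{d}$ with $h_j^*\in\mathbb{C}$ (equivalently $\sum_{t\ge 0}f(t)x^t=\frac{\sum_{j=0}^d h_j^*x^j}{(1-x)^{d+1}}$). A non-zero polynomial $f$ of degree $d$ is called Stanley non-negative (SNN) if $(h_0^*,\ldots,h_d^* )\in(\mathbb{R}_{\ge 0})^{d+1}$. A lattice polytope is a convex polytope $P\subset\mathbb{R}^n$ (for some $n$) all of whose vertices lie in $\mathbb{Z}^n$; its dimension is the dimension of its affine span. If $P$ has dimension $d$, the number of points of $\mathbb{Z}^n$ in the dilate $tP$, for non-negative integers $t$, is given by a polynomial $L_P(t)$ of degree $d$, called the Ehrhart polynomial of $P$; a polynomial is an Ehrhart polynomial if it equals $L_P$ for some lattice polytope $P$. By Stanley's non-negativity theorem, the numbers $h_j^*$ of an Ehrhart polynomial are non-negative integers, so every Ehrhart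 polynomial is SNN. *)

(* Defs.v *)
From mathcomp Require Import all_boot all_order all_algebra.
From mathcomp Require Import finmap.
From mathcomp Require Import boolp classical_sets cardinality reals convex.
From mathcomp Require Import complex.

Set Implicit Arguments.
Unset Strict Implicit.
Unset Printing Implicit Defensive.

Import Order.TTheory GRing.Theory Num.Theory.
Local Open Scope classical_set_scope.
Local Open Scope ring_scope.

(* The polynomial binom(t + k, d) = (t + k)(t + k - 1)...(t + k - d + 1) / d!. *)
Definition binom_poly (F : fieldType) (d : nat) (k : int) : {poly F} :=
  (d`!%:R)^-1 *: \prod_(i < d) ('X + (k - i%:Z)%:~R%:P).

Definition is_hstar (F : fieldType) (d : nat) (f : {poly F})
    (h : 'I_d.+1 -> F) : Prop :=
  f = \sum_(j < d.+1) h j *: binom_poly F d (d%:Z - j%:Z).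

(* In the order of R[i], 0 <= z means that z is real and non-negative. *)
Definition SNN (R : realType) (f : {poly R[i]}) : Prop :=
  f != 0 /\
  exists h : 'I_(size f).-1.+1 -> R[i], is_hstar f h /\ forall j, 0 <= h j.

Definition convex_hull (R : realType) (n : nat) (A : set 'rV[R]_n) :
  set 'rV[R]_n := smallest (@convex_set R 'rV[R]_n) A.

Definition convex_polytope (R : realType) (n : nat) (P : set 'rV[R]_n) : Prop :=
  exists2 A : set 'rV[R]_n, finite_set A & P = convex_hull A.

(* For a polytope, the vertices (0-dimensional faces) are the extreme points. *)
Definition vertex (R : realType) (n : nat) (P : set 'rV[R]_n) (v : 'rV[R]_n) :
    Prop :=
  P v /\ forall (x y : 'rV[R]_n) (t : R), P x -> P y -> 0 < t < 1 ->
    v = t *: x + (1 - t) *: y -> x = v /\ y = v.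

Definition lattice (R : realType) (n : nat) : set 'rV[R]_n :=
  [set v | v \is a mxOver Num.int].

Definition lattice_polytope (R : realType) (n : nat) (P : set 'rV[R]_n) :
    Prop :=
  convex_polytope P /\ vertex P `<=` @lattice R n.

Definition dilate (R : realType) (n : nat) (t : nat) (P : set 'rV[R]_n) :
  set 'rV[R]_n := [set t%:R *: x | x in P].

(* The dilates of a polytope are bounded, so the set counted here is finite
   and fset_set does not take its default value. *)
Definition lattice_count (R : realType) (n : nat) (P : set 'rV[R]_n) (t : nat) :
  nat := #|` fset_set (dilate t P `&` @lattice R n)|.

Definition is_ehrhart_poly_of (R : realType) (n : nat) (P : set 'rV[R]_n)
    (f : {poly R[i]}) : Prop :=
  forall t : nat, f.[t%:R] = (lattice_count P t)%:R.

Definition is_ehrhart_poly (R : realType) (f : {poly R[i]}) : Prop :=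
  exists (n : nat) (P : set 'rV[R]_n),
    lattice_polytope P /\ is_ehrhart_poly_of P f.

Definition strip5 (R : realType) (z : R[i]) : Prop :=
  (-5 <= complex.Re z <= 4)%R.

(* Main.v *)
Require Import Defs.
From mathcomp Require Import all_boot all_order all_algebra.
From mathcomp Require Import finmap interval_inference.
From mathcomp Require Import boolp classical_sets cardinality reals convex.
From mathcomp Require Import complex zify ring lra.
Import Order.TTheory GRing.Theory Num.Theory.
Local Open Scope ring_scope.
Set Implicit Arguments.
Unset Strict Implicit.
Unset Printing Implicit Defensive.

(** Lift a lattice polytope to height 1 and triangulate the cone over it by its lower faces for
    a generic cost [w]. Moving each point of the cone slightly in a generic interior direction [q]
    turns the triangulation into a partition into half-open simplicial cones, and a lattice point
    of such a cone is uniquely a box point plus a nonnegative integer combination of the vertices.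
    Counting box points by height gives Stanley's theorem [h*_j >= 0]. Reflecting the box points
    of top height [d] through the centre of their box gives distinct non-vertex lattice points of
    the polytope, whence [h*_d <= h*_1].

    For [d = 5] let [B_j] be the value of the [j]-th basis polynomial at a root [z]. For
    [Re z > 4] and [Im z > 0] the arguments of [B_1, ..., B_4] exceed that of [B_0] by less than
    a half-turn, and since [h*_5 <= h*_1] the possible overshoot of [B_5] is compensated by
    [B_1]; so [Im (conj B_0 * sum_j h*_j B_j) = 0] is impossible unless [h*] vanishes beyond
    [h*_0], and then the sum is [h*_0 B_0 <> 0]. The case [Re z < -5] follows from
    [z -> -1 - z], which reverses the vector [h*], with [B_5] in place of [B_0]. Without
    [h*_5 <= h*_1] the overshoot of [B_5] yields an SNN polynomial with a root outside the strip. *)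

(** * Infinitesimal perturbations and generic vectors over an ordered field *)

Section Generic.
Context {R : realFieldType}.

(** Makes infinitesimal displacements actual: for finitely many pairs, one [e] keeps the first-order
    terms from overturning the sign of nonzero leading terms. *)
Lemma small_eps (s : seq (R * R)) :
  exists2 e, 0 < e & forall p, p \in s -> p.1 != 0 -> e * `|p.2| < `|p.1|.
Proof.
elim: s => [|[a b] s [e e0 IH]]; first by exists 1.
have [->|a0] := eqVneq a 0.
  by exists e => // p; rewrite inE => /predU1P[->|/IH//]; rewrite eqxx.
pose d := `|a| / (`|b| + 1).
have b1 : 0 < `|b| + 1 by rewrite ltr_wpDl.
have d0 : 0 < d by rewrite divr_gt0 // normr_gt0.
exists (Num.min e d); first by rewrite lt_min e0.
move=> p; rewrite inE => /predU1P[-> _ /=|/IH h /h].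
  apply: (@le_lt_trans _ _ (d * `|b|)); first by rewrite ler_wpM2r // ge_min lexx orbT.
  rewrite /d mulrAC ltr_pdivrMr // mulrDr mulr1 ltrDl normr_gt0 //.
by apply: le_lt_trans; rewrite ler_wpM2r // ge_min lexx.
Qed.

(* The sign of [a + e * b] for infinitesimal [e > 0]. *)
Definition lexpos (a b : R) := (0 < a) || ((a == 0) && (0 < b)).

Lemma lexpos_eps (e a b : R) :
  0 < e -> (a != 0 -> e * `|b| < `|a|) -> lexpos a b = (0 < a + e * b).
Proof.
move=> e0; rewrite /lexpos; case: (ltgtP a 0) => [a0|a0|->] /= h.
- have := h isT; rewrite (ltr0_norm a0) => {}h; apply/esym/negbTE; rewrite -leNgt.
  have := ler_norm b; nra.
- have := h isT; rewrite (gtr0_norm a0) => {}h; apply/esym.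
  have := ler_norm (- b); rewrite normrN; nra.
- by rewrite add0r pmulr_rgt0.
Qed.

Lemma poly_nonroot (p : {poly R}) : p != 0 -> exists2 s, 0 < s & ~~ root p s.
Proof.
move=> p0; pose rs := [seq (i.+1)%:R : R | i <- iota 0 (size p)].
have [/allP h|] := boolP (all (root p) rs).
  have : (size rs < size p)%N.
    apply: max_poly_roots => //; first exact/allP.
    by rewrite map_inj_uniq ?iota_uniq // => i j /eqP; rewrite eqr_nat => /eqP[].
  by rewrite size_map size_iota ltnn.
by move=> /allPn[_ /mapP[i _ ->] h]; exists i.+1%:R.
Qed.

(* The witness is a point (1, s, ..., s^(N-1)) of the moment curve. *)
Lemma generic_vector (N : nat) (cs : seq 'cV[R]_N) :
  (forall c, c \in cs -> c != 0) ->
  exists2 g : 'rV[R]_N, (forall i, 0 < g 0 i) &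
    forall c, c \in cs -> (g *m c) 0 0 != 0.
Proof.
move=> h; pose p (c : 'cV[R]_N) : {poly R} := \sum_i c i 0 *: 'X^i.
have pE c k : (p c)`_(nat_of_ord k) = c k 0.
  rewrite coef_sum (bigD1 k) //= coefZ coefXn eqxx mulr1 big1 ?addr0 // => i ik.
  by rewrite coefZ coefXn eq_sym (inj_eq val_inj) (negPf ik) mulr0.
(* A non-root of the product of all the [p c] serves every vector of [cs] at once. *)
have [s s0 hs] : exists2 s, 0 < s & ~~ root (\prod_(c <- cs) p c) s.
  apply: poly_nonroot; rewrite prodf_seq_neq0; apply/allP => c /h c0 /=.
  apply: contraNneq c0 => pc0; apply/eqP/matrixP => i j.
  by rewrite ord1 -pE pc0 coef0 mxE.
exists (\row_i s ^+ i) => [i|c cin]; first by rewrite mxE exprn_gt0.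
move: hs; rewrite /root horner_prod prodf_seq_neq0 => /allP /(_ _ cin) /=.
apply: contraNneq; rewrite mxE horner_sum => h0; apply/eqP; rewrite -[RHS]h0.
by apply: eq_bigr => i _; rewrite !mxE hornerZ hornerXn mulrC.
Qed.

Lemma rowDZE (n : nat) (c g : 'rV[R]_n) e i : (c + e *: g) 0 i = c 0 i + e * g 0 i.
Proof. by rewrite !mxE. Qed.
End Generic.

(** * Regular triangulation of a cone *)

Section Triangulation.
Context {R : realFieldType} {N m : nat}.
Variables (W : 'M[R]_(N, m)) (l : 'cV[R]_m).
Hypothesis Wl : W *m l = const_mx 1.
Implicit Types (F G : {set 'I_N}) (c g : 'rV[R]_N).

Definition nonneg c := forall i, 0 <= c 0 i.
Definition supported c F := forall i, i \notin F -> c 0 i = 0.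
Definition indep F := forall c, supported c F -> c *m W = 0 -> c = 0.

(** Row [i] of [L] expresses row [i] of [W] through the rows in [F], so the existence of [L] says
    that [F] spans, and [c *m L] gives the coordinates of [c *m W] over [F]. *)
Definition coord_matrix F (L : 'M[R]_N) :=
  [/\ indep F, L *m W = W & forall i, supported (row i L) F].
Definition basis F : bool := `[< exists L, coord_matrix F L >].
Definition coordm F := xget 1%:M [set L | coord_matrix F L]%classic.

Lemma coordmP F : basis F -> coord_matrix F (coordm F).
Proof. by move=> /asboolP [L hL]; rewrite /coordm; case: xgetP => // /(_ L). Qed.

Lemma supportedB c g F : supported c F -> supported g F -> supported (c - g) F.
Proof. by move=> hc hg i iF; rewrite !mxE hc // hg // subr0. Qed.

Lemma supported_delta F i : i \in F -> supported (delta_mx 0 i) F.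
Proof. by move=> iF k kF; rewrite mxE eqxx /=; case: eqP kF => // ->; rewrite iF. Qed.

(** The functional [l] is 1 on every row of [W], so the total weight depends only on the point
    [c *m W]: it is its height. *)
Lemma sum_eq_mass c : \sum_i c 0 i = (c *m W *m l) 0 0.
Proof. by rewrite -mulmxA Wl mxE; apply: eq_bigr => i _; rewrite mxE mulr1. Qed.

Section Basis.
Variable F : {set 'I_N}.
Hypothesis bF : basis F.
Notation L := (coordm F).

Lemma coordmW : L *m W = W. Proof. by have [] := coordmP bF. Qed.

Lemma basis_indep : indep F. Proof. by have [] := coordmP bF. Qed.

Lemma coord_supp c : supported (c *m L) F.
Proof.
move=> i iF; rewrite mxE big1 // => j _.
by have [_ _ /(_ j i iF)] := coordmP bF; rewrite mxE => ->; rewrite mulr0.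
Qed.

Lemma coordK c : c *m L *m W = c *m W. Proof. by rewrite -mulmxA coordmW. Qed.

Lemma coord_id c : supported c F -> c *m L = c.
Proof.
move=> sc; apply/eqP; rewrite -subr_eq0; apply/eqP; apply: basis_indep.
  exact: supportedB (coord_supp _) sc.
by rewrite mulmxBl coordK subrr.
Qed.

Lemma coord_eq c g : c *m W = g *m W -> c *m L = g *m L.
Proof.
move=> h; apply/eqP; rewrite -subr_eq0; apply/eqP; apply: basis_indep.
  exact: supportedB (coord_supp _) (coord_supp _).
by rewrite mulmxBl !coordK h subrr.
Qed.

Lemma coordmE i j : i \in F -> L i j = (i == j)%:R.
Proof.
move=> iF; have := @coord_id (delta_mx 0 i).
rewrite -rowE => h; have /rowP /(_ j) : row i L = delta_mx 0 i.
  exact/h/supported_delta.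
by rewrite !mxE eqxx /= eq_sym.
Qed.

Lemma coord_mass c : \sum_i (c *m L) 0 i = \sum_i c 0 i.
Proof. by rewrite !sum_eq_mass coordK. Qed.
End Basis.

(** A maximal independent set containing [F] spans: adjoining an outside row [j] creates a
    dependency with nonzero coefficient at [j], which is solved for row [j]. *)
Lemma extend_basis F : indep F -> exists2 G : {set 'I_N}, F \subset G & basis G.
Proof.
move=> iF; have /asboolP iF' := iF.
have [G /maxsetP [/asboolP iG mG] FG] := maxset_exists (P := fun K => `[< indep K >]) iF'.
exists G => //; apply/asboolP.
have [A hA] : {A : 'I_N -> 'rV[R]_N &
    forall j, supported (A j) G /\ A j *m W = row j W}.
  apply: (@choice _ _ (fun j a => supported a G /\ a *m W = row j W)) => j.
  have [jG|jG] := boolP (j \in G).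
    by exists (delta_mx 0 j); rewrite -rowE; split=> //; apply: supported_delta.
  have /asboolPn : ~~ `[< indep (j |: G) >].
    apply: contra jG => /mG /(_ (finset.subsetUr _ _)) E.
    by have := setU11 j G; rewrite E.
  move=> /existsNP [c] /not_implyP [sc] /not_implyP [cW c0].
  have cj : c 0 j != 0.
    apply/negP => /eqP cj; apply: c0; apply: iG => // i iG'.
    by have [->//|ij] := eqVneq i j; apply: sc; rewrite !inE negb_or ij.
  exists (delta_mx 0 j - (c 0 j)^-1 *: c); split.
    move=> i iG'; rewrite !mxE eqxx /=; have [->|ij] := eqVneq i j.
      by rewrite mulVf // subrr.
    have ci : c 0 i = 0 by apply: sc; rewrite in_setU1 negb_or ij.
    by rewrite ci mulr0 subr0.
  by rewrite mulmxBl -scalemxAl cW scaler0 subr0 -rowE.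
exists (\matrix_j A j); split=> //.
  by apply/row_matrixP => j; rewrite row_mul rowK; have [] := hA j.
by move=> j; rewrite rowK; have [] := hA j.
Qed.

Variable w : 'cV[R]_N.

(* Caratheodory's argument: move along a linear dependency that does not increase the cost until
   some coefficient vanishes. *)
Lemma feasible_basis c : nonneg c -> exists G, [/\ basis G, nonneg (c *m coordm G) &
  (c *m coordm G *m w) 0 0 <= (c *m w) 0 0].
Proof.
have [k] := ubnP #|[set i | c 0 i != 0]|; elim: k c => // k IH c ck c0.
pose F := [set i | c 0 i != 0].
have sc : supported c F by move=> i; rewrite inE negbK => /eqP.
have [/extend_basis [G FG bG]|] := pselect (indep F).
  exists G; rewrite coord_id //; move=> i iG; apply: sc.
  by apply: contra iG; apply: (fintype.subsetP FG).
move=> /existsNP [z0] /not_implyP [sz0] /not_implyP [z0W z00].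
have [z [sz zW zn0 zw]] : exists z, [/\ supported z F, z *m W = 0, z <> 0 & 0 <= (z *m w) 0 0].
  have [h|h] := leP 0 ((z0 *m w) 0 0); first by exists z0.
  exists (- z0); split; rewrite ?mulNmx ?z0W ?oppr0 //.
  - by move=> i iF; rewrite mxE sz0 ?oppr0.
  - by move/eqP; rewrite oppr_eq0 => /eqP.
  - by rewrite mxE oppr_ge0 ltW.
(* A dependency has total weight zero, so a nonzero one has a positive coefficient. *)
have [i0 zi0] : exists i, 0 < z 0 i.
  apply: contrapT => /forallNP h; apply: zn0; apply/rowP => i; rewrite mxE.
  have hn j : z 0 j <= 0 by rewrite leNgt; exact/negP.
  have : \sum_j - z 0 j = 0 by rewrite sumrN sum_eq_mass zW mul0mx mxE oppr0.
  move/psumr_eq0P => H; apply/eqP; rewrite -oppr_eq0; apply/eqP/H => // j _.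
  by rewrite oppr_ge0.
(* The ratio test: the least ratio [th] is the longest step along [- z] that keeps the coefficients
   nonnegative, and the coefficient at [i1] becomes zero. *)
case: (@arg_minP _ R 'I_N i0 (fun i => 0 < z 0 i) (fun i => c 0 i / z 0 i) zi0).
move=> i1 z1 hmin; pose th := c 0 i1 / z 0 i1; pose c' := c - th *: z.
have th0 : 0 <= th by rewrite divr_ge0 // ltW.
have c'W : c' *m W = c *m W by rewrite mulmxBl -scalemxAl zW scaler0 subr0.
have c'0 : nonneg c'.
  move=> i; rewrite !mxE subr_ge0; have [zi|zi] := leP (z 0 i) 0.
    by apply: le_trans (c0 i); rewrite mulr_ge0_le0.
  by rewrite -ler_pdivlMr // hmin.
have [||G [bG nG hG]] := IH c' => //.
  rewrite -ltnS; apply: leq_trans ck; rewrite ltnS; apply: proper_card.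
  apply/properP; split.
    apply/fintype.subsetP => i; rewrite !inE; apply: contra => /eqP ci.
    have zi : z 0 i = 0 by apply: sz; rewrite inE ci eqxx.
    by rewrite !mxE ci zi mulr0 subr0.
  exists i1; rewrite !inE.
    by apply: contraTneq z1 => ci; rewrite sz ?ltxx // inE ci eqxx.
  have zn : z 0 i1 != 0 by rewrite gt_eqF.
  by rewrite !mxE divfK // subrr eqxx.
exists G; rewrite -(coord_eq bG c'W); split=> //; apply: le_trans hG _.
by rewrite mulmxBl -scalemxAl !mxE gerBl mulr_ge0 //; move: zw; rewrite mxE.
Qed.

(* [F] is a maximal cell of the regular triangulation with heights [w]: the reduced costs of the
   rows outside [F] are positive. *)
Definition facet F :=
  basis F && [forall j, (j \notin F) ==> ((coordm F *m w) j 0 < w j 0)].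

(* The point [c *m W], moved infinitesimally along [g], lies in the open cone over [F]. *)
Definition feas F c g :=
  [forall i, (i \in F) ==> lexpos ((c *m coordm F) 0 i) ((g *m coordm F) 0 i)].

(** A single [e] works for all [F] and [i], so [feas] becomes positivity of the coordinates of the
    actual point given by [c + e *: g]. *)
Lemma eps_family (c g : 'rV[R]_N) : exists2 e, 0 < e & forall F i,
  lexpos ((c *m coordm F) 0 i) ((g *m coordm F) 0 i) =
    (0 < ((c + e *: g) *m coordm F) 0 i) /\
  (((c *m coordm F) 0 i != 0) -> e * `|(g *m coordm F) 0 i| < `|(c *m coordm F) 0 i|).
Proof.
have [e e0 he] := small_eps [seq ((c *m coordm k.1) 0 k.2, (g *m coordm k.1) 0 k.2)
  | k <- enum {: {set 'I_N} * 'I_N}].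
exists e => // F i.
have h : (c *m coordm F) 0 i != 0 -> e * `|(g *m coordm F) 0 i| < `|(c *m coordm F) 0 i|.
  apply: (he (_, _)); apply/mapP; exists (F, i) => //; exact: mem_enum.
by split=> //; rewrite (lexpos_eps e0 h) mulmxDl -scalemxAl rowDZE.
Qed.

(** Linear programming duality with complementary slackness: reduced costs vanish on [F] and are
    positive off [F], so equality forces the support of [c] into [F]. *)
Lemma cost_facet F c : facet F -> nonneg c ->
  (c *m coordm F *m w) 0 0 <= (c *m w) 0 0 ?= iff [forall i, (0 < c 0 i) ==> (i \in F)].
Proof.
move=> /andP [bF /forallP dF] c0; rewrite -mulmxA mxE [in X in _ <= X ?= iff _]mxE.
have dual_le i : (coordm F *m w) i 0 <= w i 0 ?= iff (i \in F).
  have [iF|iF] := boolP (i \in F).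
    apply/leifP/eqP; rewrite mxE (bigD1 i) //= coordmE // eqxx mul1r big1 ?addr0 // => j ji.
    by rewrite coordmE // eq_sym (negPf ji) mul0r.
  by apply/leifP; have /implyP := dF i; apply.
suff -> : [forall i, (0 < c 0 i) ==> (i \in F)] = [forall i, (c 0 i == 0) || (i \in F)].
  apply: leif_sum => i _; have := c0 i; rewrite le0r; case: eqP => [-> _|_ /= ci].
    by rewrite !mul0r; apply/leifP; rewrite eqxx.
  by apply/leifP; move/leifP: (dual_le i); case: ifP => _; [move/eqP->|rewrite ltr_pM2l].
by apply: eq_forallb => i; have := c0 i; rewrite le0r; case: eqP => [->|_ /= ->] //; rewrite ltxx.
Qed.

(** The displaced point is a positive combination over [F] and over [G]. By [cost_facet] neither
    costs more than the other, and the equality cases give both inclusions. *)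
Lemma facet_uniq F G c c' g : facet F -> facet G -> c *m W = c' *m W ->
  feas F c g -> feas G c' g -> F = G.
Proof.
move=> fF fG ccW /forallP feF /forallP feG.
have [bF bG] : basis F /\ basis G by move: fF fG => /andP[? _] /andP[? _].
have [e e0 he] := eps_family c g.
pose a K := (c + e *: g) *m coordm K.
have a0 K i : basis K -> (forall i, i \in K -> 0 < a K 0 i) -> 0 <= a K 0 i.
  move=> bK aK; have [/aK/ltW//|iK] := boolP (i \in K).
  by rewrite coord_supp.
have aF i : i \in F -> 0 < a F 0 i.
  by move=> iF; rewrite -(he F i).1; have /implyP := feF i; apply.
have aG i : i \in G -> 0 < a G 0 i.
  move=> iG; rewrite -(he G i).1 (coord_eq bG ccW).
  by have /implyP := feG i; apply.
have EF : a G *m coordm F = a F by apply: coord_eq => //; rewrite coordK.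
have EG : a F *m coordm G = a G by apply: coord_eq => //; rewrite coordK.
have hF := cost_facet fF (fun i => a0 G i bG aG).
have hG := cost_facet fG (fun i => a0 F i bF aF).
rewrite EF in hF; rewrite EG in hG.
have E : (a F *m w) 0 0 = (a G *m w) 0 0 by apply: le_anti; rewrite hF hG.
rewrite E in hF hG.
move: hF.2 hG.2; rewrite eqxx => /esym/forallP sF /esym/forallP sG.
apply/eqP; rewrite finset.eqEsubset; apply/andP; split; apply/fintype.subsetP => i iF.
  by have /implyP := sG i; apply; apply: aF.
by have /implyP := sF i; apply; apply: aG.
Qed.

Variable q : 'rV[R]_N.
Hypothesis q0 : forall i, 0 < q 0 i.
Hypothesis q_generic : forall F i, basis F -> i \in F -> (q *m coordm F) 0 i != 0.
Hypothesis w_generic : forall F j, basis F -> j \notin F -> (coordm F *m w) j 0 != w j 0.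

(** Minimise the cost over the bases in which the displaced point has nonnegative coordinates.
    Genericity of [q] makes the optimal coordinates positive on the basis; a row of negative reduced
    cost could then enter and lower the cost. *)
Lemma facet_exists c : nonneg c -> exists2 F, facet F & feas F c q.
Proof.
move=> c0; have [e e0 he] := eps_family c q.
pose c1 := c + e *: q.
have c10 : nonneg c1 by move=> i; rewrite !mxE addr_ge0 // mulr_ge0 ?ltW.
have [F0 [bF0 nF0 _]] := feasible_basis c10.
pose P F := basis F && [forall i, 0 <= (c1 *m coordm F) 0 i].
have PF0 : P F0 by rewrite /P bF0; apply/forallP.
case: (@arg_minP _ R _ F0 P (fun F => (c1 *m coordm F *m w) 0 0) PF0).
move=> F /andP [bF /forallP nF] minF; pose a := c1 *m coordm F.
have apos i : i \in F -> 0 < a 0 i.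
  move=> iF; rewrite lt0r nF andbT.
  have qi := q_generic bF iF; have [_ h] := he F i.
  rewrite /a mulmxDl -scalemxAl rowDZE.
  have [->|/h {}h] := eqVneq ((c *m coordm F) 0 i) 0.
    by rewrite add0r mulf_neq0 // gt_eqF.
  rewrite addr_eq0; apply: contraTneq h => ->.
  by rewrite normrN normrM (gtr0_norm e0) ltxx.
exists F; last first.
  by apply/forallP => i; apply/implyP => iF; rewrite (he F i).1 apos.
rewrite /facet bF; apply/forallP => j; apply/implyP => jF.
rewrite lt_neqAle w_generic //= leNgt; apply/negP => hj.
(* The pivot direction: it brings in row [j] at the expense of [F] without moving the point, and a
   small step [t] keeps the coordinates on [F] nonnegative. *)
pose d : 'rV_N := delta_mx 0 j - row j (coordm F).
have dW : d *m W = 0 by rewrite mulmxBl -!rowE -row_mul coordmW // subrr.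
have dw : (d *m w) 0 0 < 0.
  by rewrite mulmxBl -rowE -row_mul !mxE subr_lt0; move: hj; rewrite mxE.
have [t t0 ht] := small_eps [seq (a 0 i, d 0 i) | i <- enum 'I_N].
pose b := a + t *: d.
have b0 : nonneg b.
  move=> i; have [iF|iF] := boolP (i \in F).
    have ai := apos _ iF.
    have /= := ht (a 0 i, d 0 i) (map_f _ (mem_enum _ i)); rewrite gt_eqF // => /(_ isT).
    by rewrite (gtr0_norm ai) rowDZE; have := ler_norm (- d 0 i); rewrite normrN; nra.
  rewrite rowDZE /a coord_supp // add0r mulr_ge0 ?(ltW t0) //.
  have [_ _ /(_ j i iF) Lj] := coordmP bF.
  by move: Lj; rewrite !mxE => ->; rewrite subr0 ler0n.
have bW : b *m W = c1 *m W by rewrite mulmxDl -scalemxAl dW scaler0 addr0 coordK.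
have [G [bG nG hG]] := feasible_basis b0.
have := minF G; rewrite /P bG -(coord_eq bG bW) /=.
have -> : [forall i, 0 <= (b *m coordm G) 0 i] by apply/forallP.
move=> /(_ isT) h; have := le_trans h hG.
by rewrite [b *m w]mulmxDl -scalemxAl rowDZE leNgt gtrDl pmulr_rlt0 // dw.
Qed.

End Triangulation.

(** * Half-open decomposition and box points *)

Definition compositions (r k : nat) : seq (seq nat) :=
  [seq map val (tval x) | x <- enum [set x : r.+1.-tuple 'I_k.+1 | \sum_(i <- x) i == k]%N].

Lemma compositions_uniq r k : uniq (compositions r k).
Proof.
rewrite map_inj_uniq ?enum_uniq // => x y /(inj_map val_inj) h.
exact/val_inj.
Qed.

Lemma size_compositions r k : size (compositions r k) = 'C(r + k, r).
Proof. by rewrite size_map -cardE card_ord_partitions. Qed.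

Lemma mem_compositions r k s :
  (s \in compositions r k) = (size s == r.+1) && (sumn s == k).
Proof.
apply/mapP/andP => [[x]|[/eqP sz /eqP sm]].
  rewrite mem_enum inE => /eqP sx ->; rewrite size_map size_tuple eqxx.
  by rewrite sumnE big_map sx.
have le_s i : i \in s -> (i < k.+1)%N.
  by move=> si; rewrite ltnS -sm sumnE (big_rem i) //= leq_addr.
have sz' : size (map (@inord k) s) == r.+1 by rewrite size_map sz.
exists (Tuple sz').
  rewrite mem_enum inE /= big_map -[X in _ == X]sm sumnE.
  by apply/eqP/eq_big_seq => i /le_s h; rewrite inordK.
by rewrite /= -map_comp -[LHS]map_id; apply/eq_in_map => i /le_s h /=; rewrite inordK.
Qed.

Section HalfOpenInterval.
Context {R : archiRealFieldType}.

(** Both intervals are fundamental domains for translation by integers; [up] selects the closed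
    end. *)
Definition half_open (up : bool) (x : R) := if up then 0 <= x < 1 else 0 < x <= 1.

Lemma half_open_uniq up (x y : R) (k n : nat) :
  half_open up x -> half_open up y -> x + k%:R = y + n%:R -> k = n.
Proof.
rewrite /half_open => hx hy e; apply/eqP; rewrite eqn_leq.
have lt1 : (k%:R : R) < (n.+1)%:R by rewrite -natr1; move: hx hy; case: up; lra.
have lt2 : (n%:R : R) < (k.+1)%:R by rewrite -natr1; move: hx hy; case: up; lra.
by move: lt1 lt2; rewrite !ltr_nat !ltnS => -> ->.
Qed.

Lemma half_open_split up (a : R) : (if up then 0 <= a else 0 < a) ->
  exists k : nat, half_open up (a - k%:R).
Proof.
case: up => /= a0.
  exists (Num.truncn a); have /andP[h1 h2] := truncn_itv a0.
  by move: h1 h2; rewrite -natr1; lra.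
(* For the interval closed at 1 the integer part is the ceiling minus one; [0 < a] makes it
   nonnegative. *)
pose z := Num.ceil a - 1; have /andP[h1 h2] := ceil_itv a.
have z0 : 0 <= z.
  rewrite /z subr_ge0 -gtz0_ge1 -(ltr_int R).
  exact: lt_le_trans a0 h2.
exists `|z|%N; have -> : (`|z|%N%:R : R) = z%:~R by rewrite -[in RHS](gez0_abs z0).
by move: h1 h2; rewrite /z intrB; lra.
Qed.
End HalfOpenInterval.

Lemma finite_bounded_int {R : archiRealFieldType} (m K : nat) :
  finite_set [set p : 'rV[R]_m | p \is a mxOver Num.int /\ forall j, `|p 0 j| <= K%:R]%classic.
Proof.
pose f (g : {ffun 'I_m -> 'I_(K + K).+1}) : 'rV[R]_m := \row_j ((g j)%:R - K%:R).
apply: (@sub_finite_set _ _ (f @` setT)%classic); last exact: finite_image.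
move=> p /= [/mxOverP ip bp].
exists [ffun j => inord (Num.truncn (p 0 j + K%:R))] => //.
apply/rowP => j; rewrite mxE ffunE.
have h : p 0 j + K%:R \is a Num.nat.
  rewrite natrEint rpredD ?natr_int //=; have := bp j; rewrite ler_norml; lra.
have e := truncnK h; rewrite inordK ?e ?addrK //.
rewrite ltnS -(ler_nat R) e natrD lerD2r; have := bp j; rewrite ler_norml; lra.
Qed.

Section BasisCard.
Context {R : realFieldType} {N m : nat}.
Variables (W : 'M[R]_(N, m)).

(** The submatrix [A] of the rows in [F] has free rows by independence, and the row space of [W] by
    spanning. *)
Lemma basis_card F : basis W F -> #|F| = \rank W.
Proof.
move=> bF; pose S : 'M[R]_(#|F|, N) := rowsub enum_val 1%:M.
pose A := S *m W.
have S_supp v : supported (v *m S) F.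
  move=> i iF; rewrite mxE big1 // => k _; rewrite !mxE.
  by case: eqP => [e|]; rewrite ?mulr0 //; move: iF; rewrite -e enum_valP.
have rfA : row_free A.
  apply: inj_row_free => v; rewrite mulmxA => /(basis_indep bF (S_supp v)) /rowP h.
  apply/rowP => k; have := h (enum_val k); rewrite !mxE (bigD1 k) //= !mxE eqxx mulr1.
  rewrite big1 ?addr0 // => j jk; rewrite !mxE (inj_eq enum_val_inj) (negPf jk).
  by rewrite mulr0.
have -> : #|F| = \rank A by rewrite (eqP rfA).
apply/eqP; rewrite eqn_leq; apply/andP; split; first exact: mxrankS (submxMl _ _).
suff E : W = (\matrix_(i, k) coordm W F i (enum_val k)) *m A.
  by rewrite [X in (\rank X <= _)%N]E; exact: mxrankS (submxMl _ _).
rewrite -[LHS](coordmW bF) /A mulmxA; congr (_ *m _).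
apply/matrixP => i j; rewrite mxE.
have [jF|jF] := boolP (j \in F); last first.
  have [_ _ /(_ i j jF)] := coordmP bF; rewrite mxE => ->; rewrite big1 // => k _.
  by rewrite !mxE; case: eqP => [e|]; rewrite ?mulr0 //; move: jF; rewrite -e enum_valP.
rewrite (bigD1 (enum_rank_in jF j)) //= !mxE enum_rankK_in // eqxx mulr1.
rewrite big1 ?addr0 // => k kj; rewrite !mxE; case: eqP => [e|]; rewrite ?mulr0 //.
by case/eqP: kj; apply: enum_val_inj; rewrite enum_rankK_in.
Qed.
End BasisCard.

Section HalfOpenDecomposition.
Context {R : archiRealFieldType} {N m r : nat}.
Variables (W : 'M[R]_(N, m)) (l : 'cV[R]_m).
Hypothesis Wl : W *m l = const_mx 1.
Hypothesis W_int : W \is a mxOver Num.int.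
Hypothesis l_int : l \is a mxOver Num.int.
Hypothesis W_rank : \rank W = r.+1.
Variable q : 'rV[R]_N.
(** One generic vector serves both as the direction of displacement and, transposed, as the cost. *)
Notation w := (q^T).
Notation L := (coordm W).
Hypothesis q0 : forall i, 0 < q 0 i.
Hypothesis q_generic : forall F i, basis W F -> i \in F -> (q *m L F) 0 i != 0.
Hypothesis w_generic : forall F j, basis W F -> j \notin F -> (L F *m w) j 0 != w j 0.
Implicit Types (F G : {set 'I_N}) (c b : 'rV[R]_N).

Definition up F i := 0 < (q *m L F) 0 i.

(** Box points are stored by their coefficients [b]; the lattice point itself is [b *m W]. *)
Definition box F b :=
  [/\ supported b F, forall i, i \in F -> half_open (up F i) (b 0 i)
    & b *m W \is a mxOver Num.int].

Lemma int_mxD (a c : 'rV[R]_m) : a \is a mxOver Num.int -> c \is a mxOver Num.int ->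
  a + c \is a mxOver Num.int.
Proof. by move=> /mxOverP ha /mxOverP hc; apply/mxOverP => i j; rewrite mxE rpredD. Qed.

Lemma int_mxB (a c : 'rV[R]_m) : a \is a mxOver Num.int -> c \is a mxOver Num.int ->
  a - c \is a mxOver Num.int.
Proof. by move=> /mxOverP ha /mxOverP hc; apply/mxOverP => i j; rewrite !mxE rpredB. Qed.

Definition cone_point (t : nat) (p : 'rV[R]_m) :=
  p \is a mxOver Num.int /\
  exists c, [/\ nonneg c, p = c *m W & \sum_i c 0 i = t%:R].

(** The coefficients lie between 0 and 1, so [b *m W] is an integer vector of bounded entries, and
    it determines [b] by independence of [F]. *)
Lemma box_finite F : basis W F -> finite_set [set b | box F b]%classic.
Proof.
move=> bF; pose K := Num.bound (\sum_j \sum_i `|W i j|).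
apply: (@sub_finite_set _ _
  ((fun p => p *m pinvmx W *m L F) @`
     [set p | p \is a mxOver Num.int /\ forall j, `|p 0 j| <= K%:R])%classic); last first.
  exact/finite_image/finite_bounded_int.
move=> b /= [sb hb ib]; exists (b *m W).
  split=> // j; rewrite mxE; apply: le_trans (ler_norm_sum _ _ _) _.
  apply: (@le_trans _ _ (\sum_j \sum_i `|W i j|)); last first.
    by apply/ltW/archi_boundP; do 2!apply: sumr_ge0 => ? _.
  rewrite [leRHS](bigD1 j) //= ler_wpDr //; first by do 2!apply: sumr_ge0 => ? _.
  apply: ler_sum => i _; rewrite normrM ler_piMl // ler_norml.
  have [iF|iF] := boolP (i \in F); last by rewrite sb // oppr_le0  !ler01.
  by move: (hb i iF); rewrite /half_open; case: (up F i); lra.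
rewrite -[RHS](coord_id bF sb); apply: coord_eq => //.
by rewrite mulmxKpV // submxMl.
Qed.

Definition boxes F : seq 'rV[R]_N := fset_set [set b | box F b]%classic.

Lemma mem_boxes F b : basis W F -> b \in boxes F <-> box F b.
Proof.
move=> bF; rewrite /boxes (in_fset_set (box_finite bF)).
by split; [move/set_mem | move=> h; apply/mem_set].
Qed.

Definition cells := [seq F <- enum {set 'I_N} | facet W w F].

Definition cell_boxes : seq ({set 'I_N} * 'rV[R]_N) :=
  [seq (F, b) | F <- cells, b <- boxes F].

Lemma cell_boxes_uniq : uniq cell_boxes.
Proof.
apply: allpairs_uniq_dep => [|F _|].
- by rewrite filter_uniq // enum_uniq.
- exact: fset_uniq.
by move=> [F b] [G c] _ _ /= [-> ->].
Qed.

Lemma mem_cell_boxes F b : (F, b) \in cell_boxes <-> facet W w F /\ box F b.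
Proof.
split=> [/allpairsPdep [G [c [h1 h2 [-> ->]]]]|[fF hb]].
  move: h1; rewrite mem_filter => /andP[fG _]; split=> //.
  by apply/mem_boxes => //; case/andP: fG.
apply/allpairsPdep; exists F, b; split=> //; first by rewrite mem_filter fF mem_enum.
by apply/mem_boxes => //; case/andP: fF.
Qed.

(** On a box point the sum is a nonnegative integer, being the value of the integral functional [l],
    so truncation loses nothing. *)
Definition height b : nat := Num.truncn (\sum_i b 0 i).

Lemma int_mass c : c *m W \is a mxOver Num.int -> \sum_i c 0 i \is a Num.int.
Proof. by move=> h; rewrite (sum_eq_mass Wl); apply/mxOverP/mxOverM. Qed.

Lemma half_open_ge0 u (x : R) : half_open u x -> 0 <= x <= 1.
Proof. by rewrite /half_open; case: u; lra. Qed.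

Lemma box_nonneg F b : box F b -> nonneg b.
Proof.
move=> [sb hb _] i; have [/hb/half_open_ge0/andP[]//|iF] := boolP (i \in F).
by rewrite sb.
Qed.

Lemma heightE F b : box F b -> (height b)%:R = \sum_i b 0 i.
Proof.
move=> hb; apply: truncnK; rewrite natrEint int_mass; last by case: hb.
by apply: sumr_ge0 => i _; apply: (box_nonneg hb).
Qed.

Lemma sum_supported c F : supported c F -> \sum_i c 0 i = \sum_(i in F) c 0 i.
Proof.
by move=> sc; rewrite (bigID (mem F)) /= [X in _ + X]big1 ?addr0.
Qed.

Lemma sum_q_gt0 : 0 < \sum_i q 0 i.
Proof.
have : \rank W != 0%N by rewrite W_rank.
case: N W q q0 =>  [W' q' q'0 /negP[]|n W' q' q'0 _].
  by rewrite (flatmx0 W') mxrank0.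
rewrite big_ord_recl ltr_pwDl // sumr_ge0 // => i _; exact: ltW.
Qed.

(** Height [r + 1] would force every coefficient on [F] to be 1, which is allowed only where [q] has
    nonpositive coordinate; but the coordinates of [q] have positive sum. *)
Lemma height_le F b : basis W F -> box F b -> (height b <= r)%N.
Proof.
move=> bF hb; rewrite -ltnS -W_rank -(basis_card bF) -(ltr_nat R) (heightE hb).
have [sb hob _] := hb; rewrite (sum_supported sb) -sumr_const.
rewrite lt_def ler_sum ?andbT; last by move=> i /hob/half_open_ge0/andP[].
apply/negP => /eqP e; have := sum_q_gt0.
rewrite -(coord_mass Wl bF) (sum_supported (coord_supp bF q)) ltNge => /negP; apply.
apply: sumr_le0 => i iF; rewrite leNgt; apply/negP => ui.
have : 0 < \sum_(j in F) (1 - b 0 j).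
  rewrite (bigD1 i) //= ltr_pwDl //.
    by have := hob i iF; rewrite /half_open /up ui subr_gt0 => /andP[].
  by apply: sumr_ge0 => j /andP[/hob/half_open_ge0/andP[_ ?] _]; rewrite subr_ge0.
by rewrite sumrB e subrr ltxx.
Qed.

Definition nat_row F (s : seq nat) : 'rV[R]_N :=
  \row_i (if i \in F then nth 0%N s (index i (enum F)) else 0%N)%:R.

Lemma nat_row_supp F s : supported (nat_row F s) F.
Proof. by move=> i iF; rewrite mxE (negPf iF). Qed.

Lemma nat_row_mass F s : size s = #|F| -> \sum_i nat_row F s 0 i = (sumn s)%:R.
Proof.
move=> sz; rewrite (sum_supported (nat_row_supp _)) -big_enum /=.
rewrite sumnE natr_sum (big_nth 0%N) sz big_mkord.
have [->|/finset.set0Pn[i0 i0F]] := eqVneq F finset.set0.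
  by rewrite enum_set0 big_nil cards0 big_ord0.
rewrite (big_nth i0) -cardE big_mkord; apply: eq_bigr => k _.
have kF : nth i0 (enum F) k \in F by rewrite -mem_enum mem_nth // -cardE.
by rewrite mxE kF index_uniq ?enum_uniq // -cardE.
Qed.

Lemma nat_row_inj F s s' : size s = #|F| -> size s' = #|F| ->
  nat_row F s = nat_row F s' -> s = s'.
Proof.
move=> sz sz' e; apply: (@eq_from_nth _ 0%N); first by rewrite sz.
move=> k; rewrite sz => kF.
have [i0 i0F] : exists i, i \in F by apply/finset.set0Pn; rewrite -card_gt0 (leq_ltn_trans _ kF).
have iF : nth i0 (enum F) k \in F by rewrite -mem_enum mem_nth // -cardE.
move/rowP/(_ (nth i0 (enum F) k)): e; rewrite !mxE iF index_uniq ?enum_uniq -?cardE //.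
by move/eqP; rewrite eqr_nat => /eqP.
Qed.

Lemma nat_row_map F (n : 'I_N -> nat) i : i \in F ->
  nat_row F (map n (enum F)) 0 i = (n i)%:R.
Proof.
move=> iF; rewrite mxE iF (nth_map i); first by rewrite nth_index // mem_enum.
by rewrite index_mem mem_enum.
Qed.

Lemma nat_row_int F s : nat_row F s *m W \is a mxOver Num.int.
Proof. by rewrite mxOverM //; apply/mxOverP => i j; rewrite mxE natr_int. Qed.

(** The closed ends match the displacement: a coefficient may vanish only where moving along [q]
    increases it. *)
Lemma box_feas F b s : basis W F -> box F b -> feas W F (b + nat_row F s) q.
Proof.
move=> bF [sb hb _]; apply/forallP => i; apply/implyP => iF.
rewrite coord_id //; last by move=> j jF; rewrite mxE sb // nat_row_supp // addr0.
have := hb i iF; rewrite mxE mxE iF /lexpos /half_open /up.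
have : 0 <= (nth 0%N s (index i (enum F)))%:R :> R by [].
move: (nth _ _ _)%:R => n n0; case: ifP => qi.
  move=> /andP[b0 _]; rewrite andbT orbC -le0r.
  exact: addr_ge0.
by move=> /andP[b0 _]; rewrite ltr_wpDr.
Qed.

Definition level_boxes t := [seq x <- cell_boxes | (height x.2 <= t)%N].

Definition cone_points t : seq 'rV[R]_m :=
  [seq (x.2 + nat_row x.1 s) *m W
     | x <- level_boxes t, s <- compositions r (t - height x.2)].

(** [facet_uniq] identifies the cells, independence the coefficients, and [half_open_uniq] their
    fractional and integer parts. *)
Lemma cell_box_uniq F b s G c s' :
    facet W w F -> facet W w G -> box F b -> box G c -> size s = r.+1 -> size s' = r.+1 ->
    (b + nat_row F s) *m W = (c + nat_row G s') *m W ->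
  [/\ F = G, b = c & s = s'].
Proof.
move=> fF fG hb hc sz sz' e; have [bF bG] : basis W F /\ basis W G.
  by move: fF fG => /andP[? _] /andP[? _].
have FG := facet_uniq fF fG e (box_feas s bF hb) (box_feas s' bG hc).
rewrite -{}FG in fG bG hc e *.
have {}e : b + nat_row F s = c + nat_row F s'.
  have := coord_eq bF e; rewrite !coord_id // => i iF.
    by case: hc => sc _ _; rewrite mxE sc // nat_row_supp // addr0.
  by case: hb => sc _ _; rewrite mxE sc // nat_row_supp // addr0.
have cF : #|F| = r.+1 by rewrite (basis_card bF).
have ss : nat_row F s = nat_row F s'.
  apply/rowP => i; have [iF|iF] := boolP (i \in F); last by rewrite !nat_row_supp.
  case: hb hc => _ /(_ _ iF) hb _ [_ /(_ _ iF) hc _].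
  move/rowP/(_ i): e; rewrite !mxE iF => e; congr _%:R.
  exact: half_open_uniq hb hc e.
split=> //; last by apply: nat_row_inj ss; rewrite cF.
by move: e; rewrite ss => /addIr.
Qed.

Lemma cone_points_uniq t : uniq (cone_points t).
Proof.
apply: allpairs_uniq_dep => [|x _|].
- by rewrite filter_uniq // cell_boxes_uniq.
- exact: compositions_uniq.
move=> _ _ /allpairsPdep[[F b] [s [h1 h2 ->]]] /allpairsPdep[[G c] [s' [h3 h4 ->]]] /= e.
move: h1 h3; rewrite !mem_filter => /andP[_ /mem_cell_boxes [fF hb]].
move=> /andP[_ /mem_cell_boxes [fG hc]].
move: h2 h4; rewrite !mem_compositions => /andP[/eqP sz _] /andP[/eqP sz' _].
by have [-> -> ->] := cell_box_uniq fF fG hb hc sz sz' e.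
Qed.

Lemma mem_cone_points t p : p \in cone_points t <-> cone_point t p.
Proof.
split.
  move=> /allpairsPdep[[F b] [s [h1 h2 ->]]] /=.
  move: h1 h2; rewrite mem_filter => /andP[/= ht /mem_cell_boxes [fF hb]].
  rewrite mem_compositions => /andP[/eqP sz /eqP sm]; split.
    by rewrite mulmxDl int_mxD ?nat_row_int //; case: hb.
  have /andP[bF _] := fF.
  exists (b + nat_row F s); split=> //.
    by move=> i; rewrite mxE addr_ge0 ?(box_nonneg hb) // mxE.
  rewrite (eq_bigr (fun i => b 0 i + nat_row F s 0 i)); last by move=> i _; rewrite mxE.
  rewrite big_split /= -(heightE hb) nat_row_mass ?(basis_card bF) ?W_rank //.
  by rewrite sm -natrD subnKC.
(* Conversely, the displaced point selects a cell, and each coordinate over it splits into a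
   half-open part and a natural number. *)
move=> [ip [c [c0 pE mc]]].
have [F fF feF] := facet_exists Wl q0 q_generic w_generic c0.
have /andP[bF _] := fF; pose a := c *m L F.
have /choice [n hn] : forall i, exists k : nat, i \in F -> half_open (up F i) (a 0 i - k%:R).
  move=> i; have [iF|iF] := boolP (i \in F); last by exists 0%N.
  have [|k hk] := @half_open_split _ (up F i) (a 0 i); last by exists k.
  have /forallP/(_ i)/implyP/(_ iF) := feF; rewrite /lexpos -/a /up.
  by case: ifP => _; rewrite ?andbF ?orbF // andbT orbC -le0r.
pose s := map n (enum F); pose b := a - nat_row F s.
have sa : supported a F by exact: coord_supp.
have sz : size s = #|F| by rewrite size_map -cardE.
have hb : box F b.
  split; first exact: supportedB sa (nat_row_supp _).
    by move=> i iF; rewrite mxE [X in _ + X]mxE nat_row_map // hn.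
  by rewrite mulmxBl int_mxB ?nat_row_int // coordK // -pE.
have hs : (height b + sumn s)%N = t.
  apply/eqP; rewrite -(eqr_nat R) natrD (heightE hb) -(nat_row_mass sz) -big_split /=.
  rewrite -mc -(coord_mass Wl bF c); apply/eqP/eq_bigr => i _.
  by rewrite mxE [X in _ + X + _]mxE subrK.
apply/allpairsPdep; exists (F, b), s; split=> /=.
- rewrite mem_filter /= -hs leq_addr /=; exact/mem_cell_boxes.
- by rewrite mem_compositions sz (basis_card bF) W_rank eqxx -hs addKn eqxx.
- by rewrite subrK coordK.
Qed.

Definition hstar (j : nat) := count (fun x => height x.2 == j) cell_boxes.

Lemma size_cone_points t :
  size (cone_points t) = (\sum_(j < r.+1) hstar j * 'C(r + t - j, r))%N.
Proof.
rewrite size_allpairs_dep sumnE big_map big_filter.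
transitivity (\sum_(x <- cell_boxes) \sum_(j < r.+1) (height x.2 == j) * 'C(r + t - j, r))%N.
  rewrite big_mkcond; apply: eq_big_seq => -[F b] /mem_cell_boxes [/andP[bF _] hb] /=.
  have hr := height_le bF hb.
  rewrite (bigD1 (Ordinal (hr : (height b < r.+1)%N))) //= eqxx mul1n big1; last first.
    by move=> j; rewrite -val_eqE /= eq_sym => /negPf ->.
  rewrite addn0; case: leqP => h; first by rewrite size_compositions addnBA.
  (* A box point higher than [t] yields no point; its binomial vanishes because the upper entry is
     below [r]. *)
  by rewrite bin_small //; lia.
rewrite exchange_big /=; apply: eq_bigr => j _.
rewrite -big_distrl /= /hstar -sum1_count /=; congr (_ * _)%N.
by rewrite [RHS]big_mkcond; apply: eq_bigr => x _; case: eqP.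
Qed.

(** * Reflected box points and the inequality between the top and first [h*] numbers *)

Section Interior.
Hypothesis W_extreme : forall k c, nonneg c -> c *m W = row k W -> c = delta_mx 0 k.
Hypothesis r_gt0 : (0 < r)%N.

Definition ones F : 'rV[R]_N := \row_i (i \in F)%:R.

Lemma ones_supp F : supported (ones F) F.
Proof. by move=> i iF; rewrite mxE (negPf iF). Qed.

(* Reflecting a half-open box through its centre gives the half-open box for the direction [- q];
   its points of height 1 stay in the cone after a small displacement along [- q]. *)
Lemma reflect_feas F b : basis W F -> box F b -> feas W F (ones F - b) (- q).
Proof.
move=> bF [sb hb _]; apply/forallP => i; apply/implyP => iF.
rewrite coord_id //; last exact: supportedB (@ones_supp F) sb.
have := hb i iF; have := q_generic bF iF.
have -> : (ones F - b) 0 i = 1 - b 0 i by rewrite !mxE iF.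
have -> : (- q *m L F) 0 i = - (q *m L F) 0 i by rewrite mulNmx mxE.
rewrite /lexpos /half_open /up oppr_gt0 subr_gt0 subr_eq0.
case: ltgtP => //= _ _ /andP[_ h]; first by rewrite h.
by rewrite andbT orbC eq_sym -le_eqVlt.
Qed.

(** After a small move along [- q] the reflected point is still in the cone; moving back along the
    strictly positive [q] represents it with all coefficients positive. A vertex has only the unit
    representation, and there is a second row because the rank exceeds 1. *)
Lemma reflect_not_vertex F b k : basis W F -> box F b -> (ones F - b) *m W <> row k W.
Proof.
move=> bF hb e; have feF := reflect_feas bF hb.
have [eps eps0 he] := eps_family W (ones F - b) (- q).
pose x := (ones F - b + eps *: - q) *m L F.
have x0 : nonneg x.
  move=> i; have [iF|iF] := boolP (i \in F); last by rewrite coord_supp.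
  by apply/ltW; rewrite -(he F i).1; have /forallP/(_ i)/implyP := feF; apply.
have y0 i : 0 < (x + eps *: q) 0 i by rewrite rowDZE ltr_wpDl // mulr_gt0.
have yW : (x + eps *: q) *m W = row k W.
  by rewrite mulmxDl coordK // -e scalerN -mulmxDl subrK.
have /rowP yE := W_extreme (fun i => ltW (y0 i)) yW.
have [j jk] : exists j, j != k.
  apply/existsP; rewrite -negb_forall; apply/negP => /forallP h.
  have : (r.+1 <= 1)%N.
    rewrite -W_rank; apply: leq_trans (rank_leq_row W) _.
    rewrite -[N]card_ord -(cards1 k) -cardsT; apply/subset_leq_card/fintype.subsetP => j _.
    by rewrite inE; apply: h.
  by rewrite ltnS leqNgt r_gt0.
by have := y0 j; rewrite yE mxE eqxx (negPf jk) ltxx.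
Qed.

(** Reflection sends height [r] to height [(r + 1) - r = 1]. It is injective because the reflected
    points are feasible for the single direction [- q], so [facet_uniq] applies; together with the
    [N] vertices the images are distinct points at height 1. *)
Lemma top_hstar_le : (hstar r + N <= size (cone_points 1))%N.
Proof.
pose f (x : {set 'I_N} * 'rV[R]_N) := (ones x.1 - x.2) *m W.
pose s1 := map f [seq x <- cell_boxes | height x.2 == r].
pose s2 := [seq row k W | k <- enum 'I_N].
have -> : (hstar r + N)%N = size (s1 ++ s2).
  by rewrite size_cat !size_map size_filter -enumT size_enum_ord.
apply: uniq_leq_size.
  rewrite cat_uniq; apply/and3P; split.
  - rewrite map_inj_in_uniq ?filter_uniq ?cell_boxes_uniq // => -[F b] [G c].
    rewrite !mem_filter => /andP[_ /mem_cell_boxes [fF hb]] /andP[_ /mem_cell_boxes [fG hc]].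
    rewrite /f /= => e.
    have [bF bG] : basis W F /\ basis W G by move: fF fG => /andP[? _] /andP[? _].
    have FG := facet_uniq fF fG e (reflect_feas bF hb) (reflect_feas bG hc).
    rewrite -{}FG in fG bG hc e *; congr (_, _).
    have := coord_eq bF e; rewrite !coord_id //; first by move/addrI/oppr_inj.
      by case: hc => sc _ _; exact: supportedB (@ones_supp F) sc.
    by case: hb => sc _ _; exact: supportedB (@ones_supp F) sc.
  - apply/hasPn => _ /mapP[k _ ->]; apply/mapP => -[[F b]].
    rewrite mem_filter => /andP[_ /mem_cell_boxes [/andP[bF _] hb]] /esym.
    exact: reflect_not_vertex.
  - rewrite map_inj_uniq ?enum_uniq // => i j e.
    have : delta_mx 0 i = delta_mx 0 j :> 'rV[R]_N.
      apply: W_extreme; last by rewrite -rowE.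
      by move=> k; rewrite mxE.
    by move/rowP/(_ i); rewrite !mxE !eqxx /=; case: eqP => // _ /eqP; rewrite oner_eq0.
move=> p; rewrite mem_cat => /orP[/mapP[[F b]]|/mapP[k _ ->]]; last first.
  apply/mem_cone_points; split.
    by apply/mxOverP => i j; rewrite mxE; apply/mxOverP.
  exists (delta_mx 0 k); rewrite -rowE; split=> //; first by move=> i; rewrite mxE.
  by rewrite (bigD1 k) //= mxE !eqxx big1 ?addr0 // => i ik; rewrite mxE (negPf ik) andbF.
rewrite mem_filter => /andP[/eqP hr /mem_cell_boxes [/andP[bF _] hb]] ->.
apply/mem_cone_points; have [sb hob ib] := hb; split.
  rewrite /f mulmxBl int_mxB // mxOverM //; apply/mxOverP => i j.
  by rewrite mxE natr_int.
exists (ones F - b); split=> //.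
  move=> i; rewrite !mxE; have [iF|iF] := boolP (i \in F).
    by rewrite subr_ge0; have /half_open_ge0/andP[] := hob i iF.
  by rewrite sb // subrr.
rewrite (eq_bigr (fun i => ones F 0 i - b 0 i)); last by move=> i _; rewrite !mxE.
rewrite sumrB -(heightE hb) hr (sum_supported (@ones_supp F)).
rewrite (eq_bigr (fun=> 1)); last by move=> i iF; rewrite mxE iF.
by rewrite sumr_const (basis_card bF) W_rank -natrB ?leqnSn // subSnn.
Qed.

End Interior.
End HalfOpenDecomposition.

Theorem hstar_decomposition {R : archiRealFieldType} {N m r : nat}
    (W : 'M[R]_(N, m)) (l : 'cV[R]_m) :
    W *m l = const_mx 1 -> W \is a mxOver Num.int -> l \is a mxOver Num.int ->
    \rank W = r.+1 ->
  exists h : nat -> nat,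
    (forall t, exists s : seq 'rV[R]_m, [/\ uniq s, forall p, p \in s <-> cone_point W t p
       & size s = (\sum_(j < r.+1) h j * 'C(r + t - j, r))%N]) /\
    ((forall k c, nonneg c -> c *m W = row k W -> c = delta_mx 0 k) -> (0 < r)%N ->
     (h r + N <= \sum_(j < r.+1) h j * 'C(r + 1 - j, r))%N).
Proof.
move=> Wl W_int l_int W_rank.
(* Both genericity conditions ask [q] to avoid finitely many hyperplanes; the boolean tells which
   condition a normal vector comes from. Each normal vector has entry 1 at its own index, hence is
   nonzero. *)
pose v (k : bool * {set 'I_N} * 'I_N) : 'cV[R]_N :=
  if k.1.1 then col k.2 (coordm W k.1.2)
  else delta_mx k.2 0 - (row k.2 (coordm W k.1.2))^T.
pose P (k : bool * {set 'I_N} * 'I_N) :=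
  basis W k.1.2 && (k.1.1 == (k.2 \in k.1.2)).
have [|q q0 hq] := @generic_vector R N [seq v k | k <- enum {: bool * {set 'I_N} * 'I_N} & P k].
  move=> c /mapP[[[u F] i]]; rewrite mem_filter => /andP[/andP[/= bF /eqP ui] _] ->.
  rewrite /v /=; apply/eqP => /colP/(_ i); rewrite ui.
  have [iF|iF] := boolP (i \in F).
    by rewrite !mxE coordmE // eqxx; apply/eqP; rewrite oner_eq0.
  have [_ _ /(_ i i iF)] := coordmP bF; rewrite !mxE eqxx => -> /=.
  by rewrite subr0; apply/eqP; rewrite oner_eq0.
have qv k : P k -> (q *m v k) 0 0 != 0.
  by move=> Pk; apply: hq; apply: map_f; rewrite mem_filter Pk mem_enum.
have q_generic F i : basis W F -> i \in F -> (q *m coordm W F) 0 i != 0.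
  move=> bF iF; have := qv (true, F, i); rewrite /P /v /= bF iF => /(_ isT).
  by rewrite colE mulmxA -colE mxE.
have w_generic F j : basis W F -> j \notin F -> (coordm W F *m q^T) j 0 != q^T j 0.
  move=> bF jF; have := qv (false, F, j); rewrite /P /v /= bF (negPf jF) => /(_ isT).
  rewrite mulmxBr -colE -[in X in _ - X](trmxK q) -trmx_mul -row_mul.
  by set x := coordm W F *m q^T; rewrite !mxE subr_eq0 eq_sym -/x.
exists (hstar W q); split=> [t|ext r0].
  exists (cone_points (r := r) W q t); split.
  - exact: cone_points_uniq.
  - by move=> p; exact: (mem_cone_points Wl).
  - exact: (size_cone_points Wl).
by rewrite -(size_cone_points Wl) //; exact: (top_hstar_le Wl).
Qed.

(** * Lattice polytopes *)

Section Polytope.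
Context {R : realType} {n : nat}.
Implicit Types (P M : set 'rV[R]_n).

Definition hull {N : nat} (V : 'M[R]_(N, n)) : set 'rV[R]_n :=
  [set p | exists c, [/\ nonneg c, \sum_i c 0 i = 1 & p = c *m V]]%classic.

Lemma convex_setP M : convex_set (M : set (convex_lmodType 'rV[R]_n)) <->
  forall x y t, M x -> M y -> 0 <= t -> t <= 1 -> M (t *: x + (1 - t) *: y).
Proof.
split=> [cM x y t Mx My t0 t1|cM x y t /set_mem Mx /set_mem My].
  by have /set_mem := cM x y (Itv01 t0 t1) (mem_set Mx) (mem_set My).
by apply/mem_set; apply: cM.
Qed.

Lemma convex_set_sum M (I : eqType) (s : seq I) (c : I -> R) (v : I -> 'rV[R]_n) :
  (forall x y t, M x -> M y -> 0 <= t -> t <= 1 -> M (t *: x + (1 - t) *: y)) ->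
  (forall i, 0 <= c i) -> (forall i, i \in s -> M (v i)) ->
  \sum_(i <- s) c i = 1 -> M (\sum_(i <- s) c i *: v i).
Proof.
move=> cM; elim: s c => [|a s IH] c c0 Mv; rewrite !(big_nil, big_cons) => hs.
  by move/eqP: hs; rewrite eq_sym oner_eq0.
have Ma : M (v a) by apply: Mv; rewrite mem_head.
have Ms i : i \in s -> M (v i) by move=> si; apply: Mv; rewrite in_cons si orbT.
have S0 : 0 <= \sum_(i <- s) c i by apply: sumr_ge0.
have SE : \sum_(i <- s) c i = 1 - c a by rewrite -hs addrAC subrr add0r.
have [z|nz] := eqVneq (1 - c a) 0.
  have ca : c a = 1 by apply/eqP; rewrite eq_sym -subr_eq0 z.
  rewrite big_seq big1 ?addr0 ?ca ?scale1r //.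
  move=> i si; suff -> : c i = 0 by rewrite scale0r.
  move/eqP: SE; rewrite z psumr_eq0 // => /allP /(_ _ si) /eqP //.
have -> : \sum_(i <- s) c i *: v i = (1 - c a) *: \sum_(i <- s) (c i / (1 - c a)) *: v i.
  by rewrite scaler_sumr; apply: eq_bigr => i _; rewrite scalerA mulrCA mulfV // mulr1.
apply: cM => //; last by rewrite -subr_ge0 -SE.
by apply: IH => // [i|]; rewrite -?mulr_suml ?SE ?mulfV // divr_ge0 // -SE.
Qed.

Lemma convex_hullE N (V : 'M[R]_(N, n)) :
  convex_hull [set row i V | i in [set: 'I_N]%classic]%classic = hull V.
Proof.
apply/seteqP; split=> p.
  apply; split; last first.
    move=> _ [k _ <-]; exists (delta_mx 0 k); rewrite -rowE; split=> //.
      by move=> i; rewrite mxE.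
    by rewrite (bigD1 k) //= mxE !eqxx big1 ?addr0 // => i ik; rewrite mxE (negPf ik) andbF.
  apply/convex_setP => _ _ t [c [c0 c1 ->]] [d [d0 d1 ->]] t0 t1.
  exists (t *: c + (1 - t) *: d); split.
  - by move=> i; rewrite !mxE addr_ge0 // mulr_ge0 // subr_ge0.
  - rewrite (eq_bigr (fun i => t * c 0 i + (1 - t) * d 0 i)); last by move=> i _; rewrite !mxE.
    by rewrite big_split /= -!mulr_sumr c1 d1 !mulr1 addrC subrK.
  - by rewrite mulmxDl !scalemxAl.
move=> [c [c0 c1 ->]] M /= [/convex_setP cM VM].
rewrite mulmx_sum_row; apply: convex_set_sum => // i _.
by apply: VM; exists i.
Qed.

Lemma polytope_hull P : convex_polytope P -> exists N, exists V : 'M[R]_(N, n), P = hull V.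
Proof.
move=> [A /finite_seqP [s ->] ->]; exists (size s), (\matrix_i s`_i).
rewrite -convex_hullE; congr convex_hull; apply/seteqP; split=> p /=.
  move=> ps; have h : (index p s < size s)%N by rewrite index_mem.
  by exists (Ordinal h); rewrite // rowK nth_index.
by move=> [k _ <-]; rewrite rowK mem_nth.
Qed.

Definition extreme_rows {N : nat} (V : 'M[R]_(N, n)) :=
  forall k c, nonneg c -> \sum_i c 0 i = 1 -> c *m V = row k V -> c = delta_mx 0 k.

(** A nontrivial representation of row [k] has [c 0 k < 1], so row [k] is a convex combination of
    the other rows. *)
Lemma delete_row N (V : 'M[R]_(N.+1, n)) k c :
  nonneg c -> \sum_i c 0 i = 1 -> c *m V = row k V -> c <> delta_mx 0 k ->
  hull V = hull (row' k V).
Proof.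
move=> c0 c1 cV cn.
have sum_k (d : 'rV[R]_N.+1) : \sum_i d 0 i = d 0 k + \sum_j d 0 (lift k j).
  by rewrite (bigD1_ord k).
have mul_k (d : 'rV[R]_N.+1) : d *m V = d 0 k *: row k V + col' k d *m row' k V.
  rewrite !mulmx_sum_row (bigD1_ord k) //=; congr (_ + _); apply: eq_bigr => j _.
  by rewrite mxE; congr (_ *: _); apply/rowP => i; rewrite !mxE.
have ck1 : c 0 k < 1.
  rewrite lt_neqAle -{2}c1 sum_k lerDl sumr_ge0 // andbT; apply/negP => /eqP ck.
  apply: cn; apply/rowP => i; rewrite mxE eqxx /=; case: (unliftP k i) => [j|] ->.
    rewrite eq_sym (negPf (neq_lift _ _)).
    move/eqP: c1; rewrite sum_k ck -subr_eq0 addrAC subrr add0r psumr_eq0 //.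
    by move/allP => /(_ j (mem_index_enum _)) /eqP.
  by rewrite eqxx ck.
have ck2 : 1 - c 0 k != 0 by rewrite subr_eq0 gt_eqF.
apply/seteqP; split=> p [d [d0 d1 ->]].
  (* Since [c - delta_mx 0 k] represents zero, adding a multiple of it keeps the point; the factor
     is the one that cancels the weight on row [k]. *)
  pose e := d + (d 0 k / (1 - c 0 k)) *: (c - delta_mx 0 k).
  have ek : e 0 k = 0.
    by rewrite !mxE !eqxx -(opprB 1) mulrN divfK // subrr.
  have eV : e *m V = d *m V by rewrite mulmxDl -scalemxAl mulmxBl cV -rowE subrr scaler0 addr0.
  have el j : e 0 (lift k j) = d 0 (lift k j) + d 0 k / (1 - c 0 k) * c 0 (lift k j).
    by rewrite !mxE eqxx eq_sym (negPf (neq_lift _ _)) subr0.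
  exists (col' k e); split.
  - by move=> j; rewrite mxE el addr_ge0 // mulr_ge0 // divr_ge0 // subr_ge0 ltW.
  - rewrite (eq_bigr (fun j => d 0 (lift k j) + d 0 k / (1 - c 0 k) * c 0 (lift k j))); last first.
      by move=> j _; rewrite mxE el.
    rewrite big_split -mulr_sumr /=.
    have -> : \sum_j c 0 (lift k j) = 1 - c 0 k by rewrite -c1 sum_k addrC addKr.
    by rewrite divfK // addrC -sum_k.
  - by rewrite -eV mul_k ek scale0r add0r.
pose e : 'rV[R]_N.+1 := \row_i (if unlift k i is Some j then d 0 j else 0).
have ek : e 0 k = 0 by rewrite mxE unlift_none.
have el j : e 0 (lift k j) = d 0 j by rewrite mxE liftK.
exists e; split.
- by move=> i; rewrite mxE; case: unliftP.
- by rewrite sum_k ek add0r -d1; apply: eq_bigr.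
- rewrite mul_k ek scale0r add0r; congr (_ *m _); apply/rowP => j.
  by rewrite [RHS]mxE el.
Qed.

Lemma polytope_extreme P : convex_polytope P ->
  exists N, exists V : 'M[R]_(N, n), P = hull V /\ extreme_rows V.
Proof.
move=> /polytope_hull [N [V PE]]; elim: N V PE => [|N IH] V PE.
  by exists 0%N, V; split=> // -[].
have [ext|] := pselect (extreme_rows V); first by exists N.+1, V.
move=> /existsNP [k] /existsNP [c] /not_implyP [c0] /not_implyP [c1] /not_implyP [cV cn].
by apply: (IH (row' k V)); rewrite PE (delete_row c0 c1 cV cn).
Qed.

(** If row [k] lies strictly between two points, the combined coefficients form the unit vector at
    [k]; both weights being positive, each point has no weight off [k]. *)
Lemma extreme_vertex N (V : 'M[R]_(N, n)) k : extreme_rows V -> vertex (hull V) (row k V).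
Proof.
move=> ext; split.
  exists (delta_mx 0 k); rewrite -rowE; split=> //; first by move=> i; rewrite mxE.
  by rewrite (bigD1 k) //= mxE !eqxx big1 ?addr0 // => i ik; rewrite mxE (negPf ik) andbF.
move=> _ _ t [a [a0 a1 ->]] [b [b0 b1 ->]] /andP[t0 t1] e.
have t1' : 0 < 1 - t by rewrite subr_gt0.
have /rowP E : t *: a + (1 - t) *: b = delta_mx 0 k.
  apply: ext.
  - by move=> i; rewrite !mxE addr_ge0 // mulr_ge0 // ltW.
  - rewrite (eq_bigr (fun i => t * a 0 i + (1 - t) * b 0 i)); last by move=> i _; rewrite !mxE.
    by rewrite big_split /= -!mulr_sumr a1 b1 !mulr1 addrC subrK.
  - by rewrite mulmxDl -!scalemxAl -e.
have ab i : i != k -> a 0 i = 0 /\ b 0 i = 0.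
  move=> ik; have /eqP := E i; rewrite !mxE (negPf ik) andbF paddr_eq0 ?mulr_ge0 ?(ltW t0) ?(ltW t1') //.
  by rewrite !mulf_eq0 (gt_eqF t0) (gt_eqF t1') /= => /andP[/eqP ? /eqP ?].
have delta (d : 'rV[R]_N) : \sum_i d 0 i = 1 -> (forall i, i != k -> d 0 i = 0) -> d *m V = row k V.
  move=> d1 dk; rewrite mulmx_sum_row (bigD1 k) //= big1 ?addr0.
    by move: d1; rewrite (bigD1 k) //= big1 ?addr0 // => -> ; rewrite scale1r.
  by move=> i ik; rewrite dk // scale0r.
by split; apply: delta => // i /ab [].
Qed.

Lemma card_fset_set_seq (T : choiceType) (A : set T) (s : seq T) :
  uniq s -> (forall x, x \in s <-> A x) -> #|` fset_set A| = size s.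
Proof.
move=> us hs; have fA : finite_set A.
  by apply/finite_seqP; exists s; apply/seteqP; split=> x /= /hs.
apply/perm_size/uniq_perm => // x; rewrite in_fset_set //.
by apply/idP/idP => [/set_mem/hs|/hs/mem_set].
Qed.

(** The column of ones records the height, so dropping it is a bijection from the lattice points of
    the cone at height [t] to those of the dilate. *)
Lemma lattice_count_cone N (V : 'M[R]_(N.+1, n)) t (s : seq 'rV[R]_(1 + n)) :
  uniq s -> (forall p, p \in s <-> cone_point (row_mx (const_mx 1) V) t p) ->
  lattice_count (hull V) t = size s.
Proof.
set W := row_mx _ _ => us hs; rewrite /lattice_count -(size_map rsubmx s).
have cW (c : 'rV[R]_N.+1) : c *m W = row_mx (const_mx (\sum_i c 0 i)) (c *m V).
  rewrite mul_mx_row; congr (row_mx _ _); apply/matrixP => i j; rewrite !mxE (ord1 i).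
  by apply: eq_bigr => k _; rewrite mxE mulr1.
have s_shape p : p \in s -> p = row_mx (const_mx t%:R) (rsubmx p).
  by move=> /hs [_ [c [_ -> <-]]]; rewrite cW row_mxKr.
apply: card_fset_set_seq.
  rewrite map_inj_in_uniq // => p p' /s_shape pE /s_shape pE' e.
  by rewrite pE e -pE'.
move=> x; split.
  move=> /mapP[p /[dup] /s_shape pE /hs [ip [c [c0 pc c1]]] ->]; split; last first.
    by apply/mxOverP => i j; rewrite mxE; apply/mxOverP.
  have -> : rsubmx p = c *m V by rewrite pc cW row_mxKr.
  (* At [t = 0] one cannot divide by [t]: the coefficients vanish, and any point of the polytope,
     here its first row, scales to the origin. *)
  have [t0|t0] := eqVneq t 0%N.
    have -> : c = 0.
      apply/rowP => i; rewrite mxE; move/eqP: c1; rewrite t0 psumr_eq0 //.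
      by move/allP => /(_ i (mem_index_enum _)) /eqP.
    exists (row 0 V); last by rewrite t0 scale0r mul0mx.
    exists (delta_mx 0 0); rewrite -rowE; split=> //; first by move=> i; rewrite mxE.
    by rewrite (bigD1 0) //= mxE !eqxx big1 ?addr0 // => i ik; rewrite mxE (negPf ik) andbF.
  have t1 : t%:R != 0 :> R by rewrite pnatr_eq0.
  exists (t%:R^-1 *: c *m V); last by rewrite -scalemxAl scalerA mulfV // scale1r.
  exists (t%:R^-1 *: c); split=> //; first by move=> i; rewrite mxE mulr_ge0 // invr_ge0.
  rewrite (eq_bigr (fun i => t%:R^-1 * c 0 i)); last by move=> i _; rewrite mxE.
  by rewrite -mulr_sumr c1 mulVf.
move=> [[_ [c [c0 c1 ->]] <-] /mxOverP ix].
apply/mapP; exists ((t%:R *: c) *m W); last by rewrite cW row_mxKr scalemxAl.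
apply/hs; split.
  rewrite cW; apply/mxOverP => i j; rewrite mxE; case: splitP => k _.
    rewrite mxE (eq_bigr (fun i => t%:R * c 0 i)); last by move=> ? _; rewrite mxE.
    by rewrite -mulr_sumr c1 mulr1 natr_int.
  by rewrite -scalemxAl.
exists (t%:R *: c); split=> //; first by move=> i; rewrite mxE mulr_ge0.
rewrite (eq_bigr (fun i => t%:R * c 0 i)); last by move=> ? _; rewrite mxE.
by rewrite -mulr_sumr c1 mulr1.
Qed.

(** The first alternative is the empty polytope. In the second, [r + 1] is the rank of the
    homogenised vertex matrix, which is at most the number of vertices; so [r + 1] may replace that
    number in the inequality. *)
Theorem ehrhart_hstar P : lattice_polytope P -> (forall t, lattice_count P t = 0%N) \/
  exists r, exists h : nat -> nat,
    [/\ forall t, lattice_count P t = (\sum_(j < r.+1) h j * 'C(r + t - j, r))%N,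
        lattice_count P 0 = 1%N
      & (0 < r)%N -> (h r + r.+1 <= lattice_count P 1)%N].
Proof.
move=> [/polytope_extreme [N [V [-> ext]]] vP]; case: N V ext vP => [|N] V ext vP.
  left=> t; rewrite /lattice_count.
  rewrite (_ : (dilate t (hull V) `&` _)%classic = set0) ?fset_set0 //.
  apply/seteqP; split=> // x [[_ [c [_ c1 _]] _] _].
  by move/eqP: c1; rewrite big_ord0 eq_sym oner_eq0.
right; pose W : 'M[R]_(N.+1, 1 + n) := row_mx (const_mx 1) V.
have W_int : W \is a mxOver Num.int.
  apply/mxOverP => i j; rewrite mxE; case: splitP => k _; first by rewrite mxE.
  by have /mxOverP/(_ 0 k) := vP _ (extreme_vertex i ext); rewrite mxE.
pose l : 'cV[R]_(1 + n) := delta_mx 0 0.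
have Wl : W *m l = const_mx 1.
  rewrite -colE; apply/colP => i; rewrite !mxE; case: splitP => k; first by rewrite mxE.
  by move=> /eqP; rewrite eq_sym.
have l_int : l \is a mxOver Num.int by apply/mxOverP => i j; rewrite mxE natr_int.
have W0 : \rank W != 0%N.
  rewrite mxrank_eq0; apply/eqP => W0; move: Wl; rewrite W0 mul0mx => /colP/(_ 0).
  by rewrite !mxE => /eqP; rewrite eq_sym oner_eq0.
have W_rank : \rank W = (\rank W).-1.+1 by rewrite prednK ?lt0n.
have [h [hs hr]] := hstar_decomposition Wl W_int l_int W_rank.
exists (\rank W).-1, h.
have count t : lattice_count (hull V) t =
    (\sum_(j < (\rank W).-1.+1) h j * 'C((\rank W).-1 + t - j, (\rank W).-1))%N.
  by have [s [us ms <-]] := hs t; apply: lattice_count_cone.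
split=> // [|r0].
  apply: (card_fset_set_seq (s := [:: 0])) => // x; rewrite inE; split=> [/eqP ->|].
    split; last by apply/mxOverP => i j; rewrite mxE rpred0.
    by exists (row 0 V); [case: (extreme_vertex 0 ext) | rewrite scale0r].
  by move=> [[y _ <-] _]; rewrite scale0r.
rewrite count; apply: leq_trans (hr _ r0).
  by rewrite leq_add2l -W_rank rank_leq_row.
move=> k c c0 cW; apply: ext => //.
  rewrite (sum_eq_mass Wl) cW rowE -mulmxA Wl mxE (bigD1 k) //= big1 ?addr0 ?mxE ?eqxx ?mulr1 //.
  by move=> i ik; rewrite mxE (negPf ik) andbF mul0r.
by move: cW; rewrite mul_mx_row row_row_mx => /eq_row_mx [].
Qed.

End Polytope.

(** * Roots in degree 5 *)

Section StripInequalities.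
Context {R : realFieldType}.
Implicit Types s u y : R.

(* Real and imaginary parts of (w - 2)(w - 1)w(w + 1)(w + 2) at w = s + y i. *)
Definition re5 s y : R := s ^+ 5 - 10 * s ^+ 3 * y ^+ 2 + 5 * s * y ^+ 4
  - 5 * (s ^+ 3 - 3 * s * y ^+ 2) + 4 * s.
Definition im5 s y : R := 5 * s ^+ 4 * y - 10 * s ^+ 2 * y ^+ 3 + y ^+ 5
  - 5 * (3 * s ^+ 2 * y - y ^+ 3) + 4 * y.

Definition cross s s' y : R := re5 s y * im5 s' y - im5 s y * re5 s' y.

Ltac positivity := lazymatch goal with
  | |- is_true (0 < _ + _) => apply: addr_gt0; positivity
  | |- is_true (0 < _ * _) => apply: mulr_gt0; positivity
  | |- is_true (0 < _%:R) => by rewrite ltr0n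
  | |- is_true (0 < _ ^+ _) => first [assumption | apply: exprn_gt0; positivity]
  | |- _ => first [assumption | by rewrite ltr01]
  end.

(* At [z = u + 4 + y i] the factors of the [j]-th basis polynomial are centred at [u + 7 - j], and
   [cross] is [Im (conj B_i * B_j)] up to a constant; its quotient by [y] turns out to be a
   polynomial in [u] and [y ^+ 2] with nonnegative coefficients, except in [cross05_45_pos]. Large
   coefficients are split in base 1000, since numerals are elaborated in unary. *)
Lemma cross01_pos u y : 0 < u -> y != 0 -> exists2 K, 0 < K & cross (u + 7) (u + 6) y = y * K.
Proof.
move=> u0 y0; have Y0 : 0 < y ^+ 2 by rewrite exprn_even_gt0.
exists (5 * ((u + 5) ^+ 2 + y ^+ 2) * ((u + 6) ^+ 2 + y ^+ 2) * ((u + 7) ^+ 2 + y ^+ 2) *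
    ((u + 8) ^+ 2 + y ^+ 2));
  first by positivity.
by rewrite /cross /re5 /im5; ring.
Qed.

Lemma cross02_pos u y : 0 < u -> y != 0 -> exists2 K, 0 < K & cross (u + 7) (u + 5) y = y * K.
Proof.
move=> u0 y0; have Y0 : 0 < y ^+ 2 by rewrite exprn_even_gt0.
exists ((300 + u * (120 + u * 10) + y ^+ 2 * 10) * ((u + 5) ^+ 2 + y ^+ 2) * ((u + 6) ^+
    2 + y ^+ 2) * ((u + 7) ^+ 2 + y ^+ 2));
  first by positivity.
by rewrite /cross /re5 /im5; ring.
Qed.

Lemma cross03_pos u y : 0 < u -> y != 0 -> exists2 K, 0 < K & cross (u + 7) (u + 4) y = y * K.
Proof.
move=> u0 y0; have Y0 : 0 < y ^+ 2 by rewrite exprn_even_gt0.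
exists ((8 * 10 ^+ 3 + 520 + u * (7 * 10 ^+ 3 + 920 + u * (2 * 10 ^+ 3 + 535 + u * (330 + u *
    15))) + y ^+ 2 * (615 + u * (330 + u * 30) + y ^+ 2 * 15)) * ((u + 5) ^+ 2 + y
    ^+ 2) * ((u + 6) ^+ 2 + y ^+ 2));
  first by positivity.
by rewrite /cross /re5 /im5; ring.
Qed.

Lemma cross04_pos u y : 0 < u -> y != 0 -> exists2 K, 0 < K & cross (u + 7) (u + 3) y = y * K.
Proof.
move=> u0 y0; have Y0 : 0 < y ^+ 2 by rewrite exprn_even_gt0.
exists ((111 * 10 ^+ 3 + 600 + u * (195 * 10 ^+ 3 + 600 + u * (129 * 10 ^+ 3 + 560 + u * (42 *
    10 ^+ 3 + u * (7 * 10 ^+ 3 + 100 + u * (600 + u * 20))))) + y ^+ 2 * (11 * 10 ^+ 3 +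
    480 + u * (18 * 10 ^+ 3 + u * (7 * 10 ^+ 3 + 800 + u * (10 ^+ 3 + 200 + u * 60))) + y
    ^+ 2 * (700 + u * (600 + u * 60) + y ^+ 2 * 20))) * ((u + 5) ^+ 2 + y ^+ 2));
  first by positivity.
by rewrite /cross /re5 /im5; ring.
Qed.

Lemma cross15_pos u y : 0 < u -> y != 0 -> exists2 K, 0 < K & cross (u + 6) (u + 2) y = y * K.
Proof.
move=> u0 y0; have Y0 : 0 < y ^+ 2 by rewrite exprn_even_gt0.
exists ((10 * 10 ^+ 3 + 80 + u * (36 * 10 ^+ 3 + 960 + u * (40 * 10 ^+ 3 + 460 + u * (19 * 10
    ^+ 3 + 200 + u * (4 * 10 ^+ 3 + 400 + u * (480 + u * 20))))) + y ^+ 2 * (140 + u * (5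
    * 10 ^+ 3 + 760 + u * (4 * 10 ^+ 3 + 560 + u * (960 + u * 60))) + y ^+ 2 * (160 + u *
    (480 + u * 60) + y ^+ 2 * 20))) * ((u + 4) ^+ 2 + y ^+ 2));
  first by positivity.
by rewrite /cross /re5 /im5; ring.
Qed.

Lemma cross25_pos u y : 0 < u -> y != 0 -> exists2 K, 0 < K & cross (u + 5) (u + 2) y = y * K.
Proof.
move=> u0 y0; have Y0 : 0 < y ^+ 2 by rewrite exprn_even_gt0.
exists ((420 + u * (10 ^+ 3 + 260 + u * (915 + u * (210 + u * 15))) + y ^+ 2 * (75 + u * (210
    + u * 30) + y ^+ 2 * 15)) * ((u + 3) ^+ 2 + y ^+ 2) * ((u + 4) ^+ 2 + y ^+ 2));
  first by positivity.
by rewrite /cross /re5 /im5; ring.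
Qed.

Lemma cross35_pos u y : 0 < u -> y != 0 -> exists2 K, 0 < K & cross (u + 4) (u + 2) y = y * K.
Proof.
move=> u0 y0; have Y0 : 0 < y ^+ 2 by rewrite exprn_even_gt0.
exists ((30 + u * (60 + u * 10) + y ^+ 2 * 10) * ((u + 2) ^+ 2 + y ^+ 2) * ((u + 3) ^+ 2
    + y ^+ 2) * ((u + 4) ^+ 2 + y ^+ 2));
  first by positivity.
by rewrite /cross /re5 /im5; ring.
Qed.

Lemma cross45_pos u y : 0 < u -> y != 0 -> exists2 K, 0 < K & cross (u + 3) (u + 2) y = y * K.
Proof.
move=> u0 y0; have Y0 : 0 < y ^+ 2 by rewrite exprn_even_gt0.
exists (5 * ((u + 1) ^+ 2 + y ^+ 2) * ((u + 2) ^+ 2 + y ^+ 2) * ((u + 3) ^+ 2 + y ^+ 2) *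
    ((u + 4) ^+ 2 + y ^+ 2));
  first by positivity.
by rewrite /cross /re5 /im5; ring.
Qed.

(** The term of [B_5] alone may have the wrong sign; an equal weight on [B_1] repairs it. *)
Lemma cross01_05_pos u y : 0 < u -> y != 0 ->
  exists2 K, 0 < K & cross (u + 7) (u + 6) y + cross (u + 7) (u + 2) y = y * K.
Proof.
move=> u0 y0; have Y0 : 0 < y ^+ 2 by rewrite exprn_even_gt0.
exists (14 * 10 ^+ 6 + 474 * 10 ^+ 3 + 880 + u * (19 * 10 ^+ 6 + 420 * 10 ^+ 3 + 800 + u * (11 *
    10 ^+ 6 + 970 * 10 ^+ 3 + 80 + u * (4 * 10 ^+ 6 + 483 * 10 ^+ 3 + 160 + u * (10 ^+ 6 +
    112 * 10 ^+ 3 + 390 + u * (183 * 10 ^+ 3 + 920 + u * (19 * 10 ^+ 3 + 340 + u * (10 ^+ 3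
    + 160 + u * 30))))))) + y ^+ 2 * (10 ^+ 6 + 419 * 10 ^+ 3 + 680 + u * (10 ^+ 6 + 526 *
    10 ^+ 3 + 360 + u * (786 * 10 ^+ 3 + 60 + u * (235 * 10 ^+ 3 + 200 + u * (39 * 10 ^+ 3 +
    900 + u * (3 * 10 ^+ 3 + 480 + u * 120))))) + y ^+ 2 * (49 * 10 ^+ 3 + 990 + u * (51 *
    10 ^+ 3 + 280 + u * (21 * 10 ^+ 3 + 780 + u * (3 * 10 ^+ 3 + 480 + u * 180))) + y ^+ 2
    * (10 ^+ 3 + 220 + u * (10 ^+ 3 + 160 + u * 120) + y ^+ 2 * 30))));
  first by positivity.
by rewrite /cross /re5 /im5; ring.
Qed.

Lemma cross05_45_pos u y : 0 < u -> y != 0 ->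
  exists2 K, 0 < K & cross (u + 7) (u + 2) y + cross (u + 3) (u + 2) y = y * K.
Proof.
move=> u0 y0; have Y0 : 0 < y ^+ 2 by rewrite exprn_even_gt0.
(* The [u]-free part of the quotient, a quartic in [y ^+ 2], is the only one with negative
   coefficients; the squares below certify its positivity. *)
have h : 0 < 365 * 10 ^+ 3 + 760 - (41 * 10 ^+ 3 + 200) * y ^+ 2
    - (3 * 10 ^+ 3 + 290) * (y ^+ 2) ^+ 2 + 500 * (y ^+ 2) ^+ 3 + 30 * (y ^+ 2) ^+ 4.
  move: (y ^+ 2) Y0 => Y Y0.
  have h1 : 0 <= Y * (2 * Y - 15) ^+ 2 by rewrite mulr_ge0 ?sqr_ge0 // ltW.
  have h2 := sqr_ge0 (Y - 8); have h3 := sqr_ge0 (Y ^+ 2 - 5); have h4 := sqr_ge0 (Y - 4).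
  lra.
exists ((365 * 10 ^+ 3 + 760 - (41 * 10 ^+ 3 + 200) * y ^+ 2
    - (3 * 10 ^+ 3 + 290) * (y ^+ 2) ^+ 2 + 500 * (y ^+ 2) ^+ 3 + 30 * (y ^+ 2) ^+ 4) +
    u*( 10 ^+ 6 + 524 * 10 ^+ 3 + u * (2 * 10 ^+ 6 + 92 * 10 ^+ 3 + 400 + u * (10 ^+ 6 + 390
    * 10 ^+ 3 + 600 + u * (514 * 10 ^+ 3 + 790 + u * (112 * 10 ^+ 3 + u * (14 * 10 ^+ 3 +
    300 + u * (10 ^+ 3 + u * 30)))))) + y ^+ 2 * (171 * 10 ^+ 3 + 400 + u * (267 * 10 ^+ 3
    + 660 + u * (132 * 10 ^+ 3 + u * (29 * 10 ^+ 3 + 100 + u * (3 * 10 ^+ 3 + u * 120))))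
    + y ^+ 2 * (20 * 10 ^+ 3 + u * (15 * 10 ^+ 3 + 300 + u * (3 * 10 ^+ 3 + u * 180)) + y
    ^+ 2 * (10 ^+ 3 + u * 120))))).
  by apply: addr_gt0; [exact: h|positivity].
by rewrite /cross /re5 /im5; ring.
Qed.

(** The squared modulus of the product is the product of the squared moduli of the five factors,
    each at least [y ^+ 2]. *)
Lemma norm5_gt0 s y : y != 0 -> 0 < re5 s y ^+ 2 + im5 s y ^+ 2.
Proof.
move=> y0; have Y0 : 0 < y ^+ 2 by rewrite exprn_even_gt0.
have -> : re5 s y ^+ 2 + im5 s y ^+ 2 = ((s - 2) ^+ 2 + y ^+ 2) * ((s - 1) ^+ 2 + y ^+ 2)
    * (s ^+ 2 + y ^+ 2) * ((s + 1) ^+ 2 + y ^+ 2) * ((s + 2) ^+ 2 + y ^+ 2).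
  by rewrite /re5 /im5; ring.
by do 4?[apply: mulr_gt0]; apply: ltr_wpDl => //; exact: sqr_ge0.
Qed.

Lemma re5_gt0 s : 2 < s -> 0 < re5 s 0.
Proof.
move=> s2; have -> : re5 s 0 = (s - 2) * (s - 1) * s * (s + 1) * (s + 2).
  by rewrite /re5; ring.
by do 4?[apply: mulr_gt0]; lra.
Qed.

Lemma strip_right u y (h0 h1 h2 h3 h4 h5 : R) : 0 < u ->
    0 < h0 -> 0 <= h1 -> 0 <= h2 -> 0 <= h3 -> 0 <= h4 -> 0 <= h5 -> h5 <= h1 ->
    h0 * re5 (u + 7) y + h1 * re5 (u + 6) y + h2 * re5 (u + 5) y + h3 * re5 (u + 4) y
      + h4 * re5 (u + 3) y + h5 * re5 (u + 2) y = 0 ->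
    h0 * im5 (u + 7) y + h1 * im5 (u + 6) y + h2 * im5 (u + 5) y + h3 * im5 (u + 4) y
      + h4 * im5 (u + 3) y + h5 * im5 (u + 2) y = 0 ->
  False.
Proof.
move=> u0 g0 g1 g2 g3 g4 g5 g15 eR eI.
(* On the real axis every basis value is positive, as all centres exceed 2. *)
have [y0|y0] := eqVneq y 0.
  have pos s h : 2 < s -> 0 <= h -> 0 <= h * re5 s y.
    by move=> s2 gh; rewrite y0 mulr_ge0 // ltW // re5_gt0.
  have p0 : 0 < h0 * re5 (u + 7) y by rewrite y0 mulr_gt0 // re5_gt0 //; lra.
  have p1 := pos (u + 6) h1 ltac:(lra) g1; have p2 := pos (u + 5) h2 ltac:(lra) g2.
  have p3 := pos (u + 4) h3 ltac:(lra) g3; have p4 := pos (u + 3) h4 ltac:(lra) g4.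
  have p5 := pos (u + 2) h5 ltac:(lra) g5.
  lra.
have [K1 K1p E1] := cross01_pos u0 y0; have [K2 K2p E2] := cross02_pos u0 y0.
have [K3 K3p E3] := cross03_pos u0 y0; have [K4 K4p E4] := cross04_pos u0 y0.
have [K5 K5p E5] := cross01_05_pos u0 y0.
(* Combining the two equations eliminates [h0] and leaves the cross terms; grouping [h1 - h5] apart
   pairs the overshoot with [K5]. Cancelling [y] makes its sign immaterial. *)
have S : (h1 - h5) * K1 + h2 * K2 + h3 * K3 + h4 * K4 + h5 * K5 = 0.
  apply: (mulfI y0); rewrite mulr0.
  have -> : y * ((h1 - h5) * K1 + h2 * K2 + h3 * K3 + h4 * K4 + h5 * K5) =
    (h1 - h5) * (y * K1) + h2 * (y * K2) + h3 * (y * K3) + h4 * (y * K4) + h5 * (y * K5) by ring.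
  rewrite -E1 -E2 -E3 -E4 -E5 -[RHS](subrr 0).
  rewrite -{1}(mulr0 (re5 (u + 7) y)) -{1}eI -(mulr0 (im5 (u + 7) y)) -eR /cross; ring.
have p1 : 0 <= (h1 - h5) * K1 by rewrite mulr_ge0 ?subr_ge0 // ltW.
have p2 := mulr_ge0 g2 (ltW K2p); have p3 := mulr_ge0 g3 (ltW K3p).
have p4 := mulr_ge0 g4 (ltW K4p); have p5 := mulr_ge0 g5 (ltW K5p).
have kill K h : 0 < K -> h * K = 0 -> h = 0.
  by move=> Kp /eqP; rewrite mulf_eq0 (gt_eqF Kp) orbF => /eqP.
have z2 : h2 = 0 by apply: kill K2p _; lra.
have z3 : h3 = 0 by apply: kill K3p _; lra.
have z4 : h4 = 0 by apply: kill K4p _; lra.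
have z5 : h5 = 0 by apply: kill K5p _; lra.
have z1 : h1 = 0.
  by have : h1 - h5 = 0; [apply: kill K1p _; lra|rewrite z5 subr0].
have := norm5_gt0 (u + 7) y0.
have -> : re5 (u + 7) y = 0.
  by apply: (mulfI (lt0r_neq0 g0)); move: eR; rewrite z1 z2 z3 z4 z5; lra.
have -> : im5 (u + 7) y = 0.
  by apply: (mulfI (lt0r_neq0 g0)); move: eI; rewrite z1 z2 z3 z4 z5; lra.
by rewrite expr0n addr0 ltxx.
Qed.

(** Mirror image of [strip_right], meant for the reversed [h*] vector: the last term is eliminated,
    and [h0 <= h4] absorbs the overshoot through [cross05_45_pos]. *)
Lemma strip_left u y (h0 h1 h2 h3 h4 h5 : R) : 0 < u ->
    0 <= h0 -> 0 <= h1 -> 0 <= h2 -> 0 <= h3 -> 0 <= h4 -> 0 < h5 -> h0 <= h4 ->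
    h0 * re5 (u + 7) y + h1 * re5 (u + 6) y + h2 * re5 (u + 5) y + h3 * re5 (u + 4) y
      + h4 * re5 (u + 3) y + h5 * re5 (u + 2) y = 0 ->
    h0 * im5 (u + 7) y + h1 * im5 (u + 6) y + h2 * im5 (u + 5) y + h3 * im5 (u + 4) y
      + h4 * im5 (u + 3) y + h5 * im5 (u + 2) y = 0 ->
  False.
Proof.
move=> u0 g0 g1 g2 g3 g4 g5 g04 eR eI.
have [y0|y0] := eqVneq y 0.
  have pos s h : 2 < s -> 0 <= h -> 0 <= h * re5 s y.
    by move=> s2 gh; rewrite y0 mulr_ge0 // ltW // re5_gt0.
  have p0 := pos (u + 7) h0 ltac:(lra) g0.
  have p1 := pos (u + 6) h1 ltac:(lra) g1; have p2 := pos (u + 5) h2 ltac:(lra) g2.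
  have p3 := pos (u + 4) h3 ltac:(lra) g3; have p4 := pos (u + 3) h4 ltac:(lra) g4.
  have p5 : 0 < h5 * re5 (u + 2) y by rewrite y0 mulr_gt0 // re5_gt0 //; lra.
  lra.
have [K1 K1p E1] := cross15_pos u0 y0; have [K2 K2p E2] := cross25_pos u0 y0.
have [K3 K3p E3] := cross35_pos u0 y0; have [K4 K4p E4] := cross45_pos u0 y0.
have [K0 K0p E0] := cross05_45_pos u0 y0.
have S : (h4 - h0) * K4 + h1 * K1 + h2 * K2 + h3 * K3 + h0 * K0 = 0.
  apply: (mulfI y0); rewrite mulr0.
  have -> : y * ((h4 - h0) * K4 + h1 * K1 + h2 * K2 + h3 * K3 + h0 * K0) =
    (h4 - h0) * (y * K4) + h1 * (y * K1) + h2 * (y * K2) + h3 * (y * K3) + h0 * (y * K0) by ring.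
  rewrite -E1 -E2 -E3 -E4 -E0 -[RHS](subrr 0).
  rewrite -{1}(mulr0 (im5 (u + 2) y)) -{1}eR -(mulr0 (re5 (u + 2) y)) -eI /cross; ring.
have p4 : 0 <= (h4 - h0) * K4 by rewrite mulr_ge0 ?subr_ge0 // ltW.
have p2 := mulr_ge0 g2 (ltW K2p); have p3 := mulr_ge0 g3 (ltW K3p).
have p1 := mulr_ge0 g1 (ltW K1p); have p0 := mulr_ge0 g0 (ltW K0p).
have kill K h : 0 < K -> h * K = 0 -> h = 0.
  by move=> Kp /eqP; rewrite mulf_eq0 (gt_eqF Kp) orbF => /eqP.
have z2 : h2 = 0 by apply: kill K2p _; lra.
have z3 : h3 = 0 by apply: kill K3p _; lra.
have z1 : h1 = 0 by apply: kill K1p _; lra.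
have z0 : h0 = 0 by apply: kill K0p _; lra.
have z4 : h4 = 0.
  by have : h4 - h0 = 0; [apply: kill K4p _; lra|rewrite z0 subr0].
have := norm5_gt0 (u + 2) y0.
have -> : re5 (u + 2) y = 0.
  by apply: (mulfI (lt0r_neq0 g5)); move: eR; rewrite z0 z1 z2 z3 z4; lra.
have -> : im5 (u + 2) y = 0.
  by apply: (mulfI (lt0r_neq0 g5)); move: eI; rewrite z0 z1 z2 z3 z4; lra.
by rewrite expr0n addr0 ltxx.
Qed.

End StripInequalities.

(** * Values, degree and leading coefficient of the binomial basis *)

Section BinomialBasis.
Context {F : numFieldType}.

Lemma binom_poly_nat d (k : int) (t m : nat) :
  t%:Z + k = m%:Z -> (binom_poly F d k).[t%:R] = 'C(m, d)%:R.
Proof.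
move=> tk; rewrite /binom_poly hornerZ horner_prod.
have -> : \prod_(i < d) ('X + (k - i%:Z)%:~R%:P).[t%:R] = (m ^_ d)%:R :> F.
  have E (i : 'I_d) : ('X + (k - i%:Z)%:~R%:P).[t%:R] = (m%:Z - i%:Z)%:~R :> F.
    by rewrite hornerD hornerX hornerC -tk -addrA [RHS]rmorphD.
  rewrite (eq_bigr _ (fun i _ => E i)) ffact_prod natr_prod.
  have [dm|md] := leqP d m.
    by apply: eq_bigr => i _; rewrite subzn // (leq_trans (ltnW (ltn_ord i)) dm).
  (* When [m < d], both products contain a zero factor, at index [m]. *)
  rewrite (bigD1 (Ordinal md)) //= subrr mul0r.
  by rewrite [RHS](bigD1 (Ordinal md)) //= subnn mul0r.
by rewrite -bin_ffact natrM mulrC mulfK // pnatr_eq0 -lt0n fact_gt0.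
Qed.

Lemma size_binom_prod d (k : int) :
  size (\prod_(i < d) ('X + (k - i%:Z)%:~R%:P) : {poly F}) = d.+1 /\
  lead_coef (\prod_(i < d) ('X + (k - i%:Z)%:~R%:P) : {poly F}) = 1.
Proof.
have -> : \prod_(i < d) ('X + (k - i%:Z)%:~R%:P) =
    \prod_(i <- enum 'I_d) ('X - (- (k - i%:Z)%:~R)%:P) :> {poly F}.
  by rewrite big_enum /=; apply: eq_bigr => i _; rewrite polyCN opprK.
by rewrite size_prod_XsubC size_enum_ord; split=> //; apply/eqP/monic_prod_XsubC.
Qed.

(** All basis polynomials share the leading coefficient [1 / d!], so the coefficient of degree [d]
    is the sum of the [h j] divided by [d!]. *)
Lemma size_hstar_poly d (h : 'I_d.+1 -> F) : \sum_j h j != 0 ->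
  size (\sum_(j < d.+1) h j *: binom_poly F d (d%:Z - j%:Z)) = d.+1.
Proof.
move=> h0; apply/eqP; rewrite eqn_leq; apply/andP; split.
  apply: (leq_trans (size_sum _ _ _)); apply/bigmax_leqP => j _.
  by rewrite !(leq_trans (size_scale_leq _ _)) // (size_binom_prod _ _).1.
rewrite ltnNge; apply/negP => /leq_sizeP /(_ d (leqnn _)).
rewrite coef_sum (eq_bigr (fun j => h j * d`!%:R^-1)) => [|j _].
  rewrite -mulr_suml => /eqP; rewrite mulf_eq0 (negPf h0) /= invr_eq0 pnatr_eq0.
  by rewrite -leqn0 leqNgt fact_gt0.
have [sz lc] := size_binom_prod d (d%:Z - j%:Z).
by rewrite !coefZ; move: lc; rewrite /lead_coef sz /= => ->; rewrite mulr1.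
Qed.

Lemma poly_eq_nat (p q : {poly F}) : (forall t : nat, p.[t%:R] = q.[t%:R]) -> p = q.
Proof.
move=> pq; apply/eqP; rewrite -subr_eq0; apply/negP => /negP pq0.
pose rs := [seq i%:R : F | i <- iota 0 (size (p - q))].
have : (size rs < size (p - q)%R)%N.
  apply: max_poly_roots => //.
    by apply/allP => _ /mapP[t _ ->]; rewrite /root hornerD hornerN pq subrr.
  by rewrite map_inj_uniq ?iota_uniq // => i j /eqP; rewrite eqr_nat => /eqP.
by rewrite size_map size_iota ltnn.
Qed.

End BinomialBasis.

(** * From [h*] vectors to the strip *)

Section Roots.
Local Open Scope complex_scope.
Context {R : realType}.

(** The five factors are consecutive shifts symmetric about the centre [x + 3 - j]. *)
Lemma binom5E (x y : R) (j : nat) :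
  (binom_poly R[i] 5 (5%:Z - j%:Z)).[x +i* y] =
    5`!%:R^-1 * (re5 (x + 3 - j%:R) y +i* im5 (x + 3 - j%:R) y).
Proof.
rewrite /binom_poly hornerZ horner_prod; congr (_ * _).
have E (i : 'I_5) : ('X + (5%:Z - j%:Z - i%:Z)%:~R%:P).[x +i* y] =
    ((x + 3 - j%:R) + 2 - i%:R) +i* y.
  rewrite hornerD hornerX hornerC !rmorphB /= -!pmulrn.
  rewrite -!(rmorph_nat (real_complex R)) /=; simpc.
  by congr (_ +i* _); ring.
rewrite (eq_bigr _ (fun i _ => E i)) !big_ord_recl big_ord0 /=.
by simpc; rewrite /re5 /im5; congr (_ +i* _); rewrite /bump /=; ring.
Qed.

Lemma ehrhart5_hstar (f : {poly R[i]}) : is_ehrhart_poly f -> size f = 6%N ->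
  exists h : nat -> nat, [/\ h 0%N = 1%N, (h 5 <= h 1)%N &
    f = \sum_(j < 6) (h j)%:R *: binom_poly R[i] 5 (5%:Z - j%:Z)].
Proof.
move=> [n [P [lP fP]]] sf.
have f0 : f != 0 by rewrite -size_poly_eq0 sf.
have [P0|[r [h [hP P1 hr]]]] := ehrhart_hstar lP.
  case/eqP: f0; apply: poly_eq_nat => t.
  by rewrite fP P0 horner0.
have fE : f = \sum_(j < r.+1) (h j)%:R *: binom_poly R[i] r (r%:Z - j%:Z).
  apply: poly_eq_nat => t; rewrite fP hP horner_sum natr_sum.
  apply: eq_bigr => j _; rewrite hornerZ natrM; congr (_ * _).
  rewrite (@binom_poly_nat _ _ _ t (r + t - j)) //.
  by rewrite -subzn; [rewrite PoszD; ring|have := ltn_ord j; lia].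
(* The [h j] are natural numbers, so a zero sum would make [f] zero; otherwise the degree of [f] is
   [r]. *)
have r5 : r = 5%N.
  have : size f = r.+1.
    rewrite fE size_hstar_poly // -natr_sum pnatr_eq0; apply/negP => /eqP S.
    case/eqP: f0; rewrite fE big1 // => j _; suff -> : h j = 0%N by rewrite scale0r.
    by apply/eqP; move/eqP: S; rewrite sum_nat_eq0 => /forallP /(_ j).
  by rewrite sf => -[].
subst r; have h01 : h 0%N = 1%N.
  move: P1; rewrite hP big_ord_recl big1 ?addn0 => [|j _]; first by rewrite binn muln1.
  by rewrite bin_small ?muln0 //= /bump /=; lia.
exists h; split=> //.
(* At [t = 1] only the first two terms survive, so the count is [6 + h 1] and the bound
   [h 5 + 6 <= 6 + h 1] remains. *)
have := hr isT; rewrite hP 2!big_ord_recl big1 ?addn0 => [/=|j _].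
  by rewrite h01 mul1n /bump /= binn muln1 (_ : 'C(5 + 1 - 0, 5) = 6%N) // addnC leq_add2l.
by rewrite bin_small ?muln0 //= /bump /=; lia.
Qed.

Lemma root_hstar (h : 'I_6 -> R) (x y : R) :
  root (\sum_(j < 6) (h j)%:C *: binom_poly R[i] 5 (5%:Z - j%:Z)) (x +i* y) <->
  \sum_(j < 6) h j * re5 (x + 3 - j%:R) y = 0 /\ \sum_(j < 6) h j * im5 (x + 3 - j%:R) y = 0.
Proof.
rewrite /root horner_sum.
rewrite (eq_bigr (fun j : 'I_6 => 5`!%:R^-1 * ((h j * re5 (x + 3 - j%:R) y) +i*
    (h j * im5 (x + 3 - j%:R) y)))); last first.
  by move=> j _; rewrite hornerZ binom5E mulrCA; congr (_ * _); simpc.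
rewrite -mulr_sumr mulf_eq0 invr_eq0 pnatr_eq0 /=.
have -> : \sum_(j < 6) (h j * re5 (x + 3 - j%:R) y +i* (h j * im5 (x + 3 - j%:R) y)) =
    (\sum_(j < 6) h j * re5 (x + 3 - j%:R) y) +i* (\sum_(j < 6) h j * im5 (x + 3 - j%:R) y).
  by rewrite !big_ord_recl !big_ord0; simpc.
by rewrite eq_complex /=; split=> [/andP[/eqP ? /eqP ?]|[-> ->]]; rewrite ?eqxx.
Qed.

Lemma ehrhart5_root_strip (f : {poly R[i]}) (z : R[i]) :
  is_ehrhart_poly f -> size f = 6%N -> root f z -> strip5 z.
Proof.
move=> ef sf; have [h [h0 h51 ->]] := ehrhart5_hstar ef sf.
case: z => x y.
rewrite (eq_bigr (fun j : 'I_6 => ((h j)%:R : R)%:C *: binom_poly R[i] 5 (5%:Z - j%:Z))); last first.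
  by move=> j _; rewrite rmorph_nat.
move=> /root_hstar []; rewrite /strip5 /= !big_ord_recl !big_ord0 /= /bump /= h0 => eR eI.
have h51' : (h 5)%:R <= (h 1)%:R :> R by rewrite ler_nat.
have [x5|x5] := ltP x (-5).
  (* Here [u + 4] is [- 1 - x]. The reflection negates the centres and reverses their order; [re5]
     is odd and [im5] even in the centre, so both equations persist with the same [y]. *)
  exfalso; pose u := - 5 - x; have u0 : 0 < u by rewrite /u; lra.
  have odd s : re5 (- s) y = - re5 s y by rewrite /re5; ring.
  have even s : im5 (- s) y = im5 s y by rewrite /im5; ring.
  have e0 : u + 7 = - (x + 3 - 5%:R) by rewrite /u; ring.
  have e1 : u + 6 = - (x + 3 - 4%:R) by rewrite /u; ring.
  have e2 : u + 5 = - (x + 3 - 3%:R) by rewrite /u; ring.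
  have e3 : u + 4 = - (x + 3 - 2%:R) by rewrite /u; ring.
  have e4 : u + 3 = - (x + 3 - 1%:R) by rewrite /u; ring.
  have e5 : u + 2 = - (x + 3 - 0%:R) by rewrite /u; ring.
  apply: (@strip_left _ u y (h 5)%:R (h 4)%:R (h 3)%:R (h 2)%:R (h 1)%:R 1 u0) => //.
  - by rewrite e0 e1 e2 e3 e4 e5 !odd; move: eR; lra.
  - by rewrite e0 e1 e2 e3 e4 e5 !even; move: eI; lra.
have [//|x4] := leP x 4.
exfalso; pose u := x - 4; have u0 : 0 < u by rewrite /u; lra.
have e0 : u + 7 = x + 3 - 0%:R by rewrite /u; ring.
have e1 : u + 6 = x + 3 - 1%:R by rewrite /u; ring.
have e2 : u + 5 = x + 3 - 2%:R by rewrite /u; ring.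
have e3 : u + 4 = x + 3 - 3%:R by rewrite /u; ring.
have e4 : u + 3 = x + 3 - 4%:R by rewrite /u; ring.
have e5 : u + 2 = x + 3 - 5%:R by rewrite /u; ring.
apply: (@strip_right _ u y 1 (h 1)%:R (h 2)%:R (h 3)%:R (h 4)%:R (h 5)%:R u0) => //.
- by rewrite e0 e1 e2 e3 e4 e5; move: eR; lra.
- by rewrite e0 e1 e2 e3 e4 e5; move: eI; lra.
Qed.

Lemma SNN5_root_outside_strip : exists f : {poly R[i]}, SNN f /\ size f = 6%N /\
  exists z : R[i], root f z /\ ~ strip5 z.
Proof.
(* The three-term relation between plane vectors makes
   [cross b2 b5 * b0 + cross b5 b0 * b2 + cross b0 b2 * b5 = 0]; at this point, found
   numerically, all three coefficients are positive. *)
pose u : R := 1000^-1; pose y : R := 14 / 5.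
have u0 : 0 < u by rewrite /u; lra.
have y0 : 0 < y by rewrite /y; lra.
have h0p : 0 < cross (u + 5) (u + 2) y.
  by have [K K0 ->] := cross25_pos u0 (lt0r_neq0 y0); rewrite mulr_gt0.
have h5p : 0 < cross (u + 7) (u + 5) y.
  by have [K K0 ->] := cross02_pos u0 (lt0r_neq0 y0); rewrite mulr_gt0.
have h2p : 0 < cross (u + 2) (u + 7) y.
  rewrite /cross /re5 /im5 /u /y; lra.
pose h (j : 'I_6) : R := [:: cross (u + 5) (u + 2) y; 0; cross (u + 2) (u + 7) y; 0; 0;
  cross (u + 7) (u + 5) y]`_j.
pose f : {poly R[i]} := \sum_(j < 6) (h j)%:C *: binom_poly R[i] 5 (5%:Z - j%:Z).
have hge j : 0 <= h j.
  by rewrite /h; case: j => [[|[|[|[|[|[|j]]]]]] ?] //=; rewrite ltW.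
have sf : size f = 6%N.
  rewrite size_hstar_poly // -rmorph_sum /= fmorph_eq0 gt_eqF //.
  by rewrite big_ord_recl ltr_pwDl // sumr_ge0.
exists f; split; [split; first by rewrite -size_poly_eq0 sf|split=> //].
  by rewrite sf; exists (fun j => (h j)%:C); split=> // j; rewrite lecR.
exists ((u + 4) +i* y); split; last by rewrite /strip5 /=; apply/negP; rewrite negb_and -!ltNge; lra.
apply/root_hstar; rewrite !big_ord_recl !big_ord0 /h /= /bump /=.
have e0 : u + 4 + 3 - 0%:R = u + 7 by ring.
have e2 : u + 4 + 3 - 2%:R = u + 5 by ring.
have e5 : u + 4 + 3 - 5%:R = u + 2 by ring.
rewrite e0 e2 e5 /cross; split; ring.
Qed.

End Roots.

(* A polynomial f has degree 5 iff size f = 6. *)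
Theorem theorem3p5 (R : realType) :
  (forall f : {poly R[i]}, SNN f -> size f = 6%N ->
     (exists z : R[i], root f z /\ ~ strip5 z) -> ~ is_ehrhart_poly f) /\
  (forall f : {poly R[i]}, is_ehrhart_poly f -> size f = 6%N ->
     forall z : R[i], root f z -> strip5 z) /\
  (exists f : {poly R[i]}, SNN f /\ size f = 6%N /\
     exists z : R[i], root f z /\ ~ strip5 z).
Proof.
split; first by move=> f _ sf [z [fz nz]] ef; apply/nz/(ehrhart5_root_strip ef sf fz).
split; last exact: SNN5_root_outside_strip.
by move=> f ef sf z; apply: ehrhart5_root_strip.
Qed.
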